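(* Let $\mathcal L=\mathcal O_C(\tilde q_1+\tilde q_2-\infty_+-\infty_-)$ with $\tilde q_i=(\xi_i,y_i)\in C$, $\xi_i\neq0$, $q_i=f(\tilde q_i)$ ($i=1,2$), $q_1\ne q_2$. Let $\mathcal E=f_*\mathcal L$, $\mathcal E_0=f_*\mathcal O_C$, and let $v_2^{(i)}=\begin{pmatrix}\xi_i\\1\end{pmatrix}$ in the basis $(1,\xi)$ (an eigenvector, with eigenvalue $1$, of the matrix $\begin{pmatrix}\frac12&\frac{\xi_i}2\\ \frac1{2\xi_i}&\frac12\end{pmatrix}$). Then $$\mathcal E=\mathrm{elm}^+_{q_1,v_2^{(1)}}\,\mathrm{elm}^+_{q_2,v_2^{(2)}}\bigl(\mathcal E_0(-\infty)\bigr).$$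
   Context: Let $t,t'\in\mathbb C\setminus\{0,1\}$, $t\neq t'$. $E$: $y^2=x(x-1)(x-t)$ with point at infinity $\infty$; $C$: $y^2=(t'-\xi^2)(t'-1-\xi^2)(t'-t-\xi^2)$ (smooth projective models); $f:C\to E$, $(\xi,y)\mapsto(t'-\xi^2,y)$, of degree $2$; $f^{-1}(\infty)=\{\infty_+,\infty_-\}$. Vector bundles are identified with locally free sheaves; $\mathcal E_0(-\infty)=\mathcal E_0\otimes\mathcal O_E(-\infty)$; $(1,\xi)$ is a basis of $\mathcal E_0$ over $E\setminus\{\infty\}$, so it gives a basis of the fibers of $\mathcal E_0$, and of $\mathcal E_0(-\infty)$, at points of $E\setminus\{\infty\}$. For a rank-$2$ bundle $\mathcal F$ on a curve, a point $p$ with local parameter $\tau_p$, and a nonzero vector $e_1$ in the fiber $\mathcal F|_p$, extend $e_1$ to a local basis $e_1,e_2$ of $\mathcal F$ near $p$; the elementary transform $\mathrm{elm}^+_{p,e_1}(\mathcal F)$ is the locally free subsheaf of the sheaf of rational sections of $\mathcal F$ having stalk $\mathcal O_p\frac1{\tau_p}e_1+\mathcal O_pe_2$ at $p$ and the same stalks as $\mathcal F$ at all other points. *)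

(* Defs.v *)
From HB Require Import structures.
From mathcomp Require Import all_boot all_order all_algebra all_field.
From mathcomp Require Import generic_quotient polyXY fraction qpoly qfpoly.
From mathcomp Require Import classical_sets cardinality reals complex.
From mathcomp Require Import ring.

Set Implicit Arguments.
Unset Strict Implicit.
Unset Printing Implicit Defensive.

Import Order.TTheory GRing.Theory Num.Theory.
Local Open Scope classical_set_scope.
Local Open Scope ring_scope.

(* A smooth projective curve is given by its closed points and their local
   rings, all inside one ambient field K.  K may be larger than the function
   field of the curve: for a dominant morphism f : X -> Y both curves live in
   K = k(X), and k(Y) is identified with its image under f^*. *)
Record curve (K : fieldType) := Curve {
  point :> choiceType;
  loc : point -> set K
}.

Section Sheaves.
Variables (K : fieldType) (X : curve K).
Implicit Types (p : X) (U : set X) (D : X -> int) (v s tau e : K).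

Definition max_ideal p : set K :=
  [set s | loc p s /\ ~ (s != 0 /\ loc p s^-1)].

Definition local_param p tau : Prop :=
  tau != 0 /\ max_ideal p = [set tau * a | a in loc p].

(* Nonempty Zariski open sets. *)
Definition zopen U : Prop := finite_set (~` U).

(* A subsheaf of the constant sheaf K, by its sections; only the values on
   nonempty open sets are meaningful, see sheaf_eq. *)
Definition subsheaf := set X -> set K.

Definition sheaf_eq (F G : subsheaf) : Prop :=
  forall U, zopen U -> F U = G U.

Definition stalk (F : subsheaf) p : set K :=
  [set s | exists U, [/\ zopen U, U p & F U s]].

Definition struct_sheaf : subsheaf :=
  fun U => [set s | forall p, U p -> loc p s].

Definition pt_div p : X -> int := fun r => (r == p)%:Z.

(* O_X(D): the order of s at p is at least - D p for every p in U. *)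
Definition div_sheaf D : subsheaf :=
  fun U => [set s | forall p, U p ->
    exists tau, local_param p tau /\ loc p (tau ^ D p * s)].

(* The additive span of the products a * b. *)
Definition mod_prod (A B : set K) : set K :=
  [set s | exists n (a b : 'I_n -> K),
    (forall i, A (a i) /\ B (b i)) /\ s = \sum_i a i * b i].

(* For G an invertible subsheaf, F (x) G is identified with its image in K
   under multiplication, the sheaf with stalks F_p . G_p. *)
Definition tensor (F G : subsheaf) : subsheaf :=
  fun U => [set s | forall p, U p -> mod_prod (stalk F p) (stalk G p) s].

Definition span2 p e1 e2 : set K :=
  [set s | exists a b, [/\ loc p a, loc p b & s = a * e1 + b * e2]].

(* (e1, e2) is a basis of the stalk F_p; for F locally free of rank 2 this is
   the same as being a basis of F on some neighbourhood of p. *)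
Definition local_basis (F : subsheaf) p e1 e2 : Prop :=
  stalk F p = span2 p e1 e2 /\
  (forall a b, loc p a -> loc p b -> a * e1 + b * e2 = 0 -> a = 0 /\ b = 0).

(* s and s' have the same image in the fiber F_p / m_p F_p. *)
Definition same_fiber (F : subsheaf) p s s' : Prop :=
  mod_prod (max_ideal p) (stalk F p) (s - s').

(* A vector of the fiber F|_p is given by a germ v in F_p representing it.  The
   module in the case r = p does not depend on the choice of tau, e1, e2. *)
Definition elm p v (F : subsheaf) : subsheaf :=
  fun U => [set s | forall r, U r ->
    if r == p then
      exists tau e1 e2, [/\ local_param p tau, local_basis F p e1 e2,
        same_fiber F p e1 v & span2 p (tau^-1 * e1) e2 s]
    else stalk F r s].

End Sheaves.

Definition pushforward (K : fieldType) (X Y : curve K) (f : X -> Y)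
  (F : subsheaf X) : subsheaf Y := fun V => F (f @^-1` V).

Fact frac_numden (A : idomainType) (z : {fraction A}) :
  exists n d : A, d != 0 /\
    z * FracField.tofrac d = FracField.tofrac n.
Proof.
elim/quotW: z => x; exists (frac x).1, (frac x).2; split; first exact: denom_ratioP.
have -> : FracField.tofrac (frac x).2 =
    (\pi_({fraction A})%qT (Ratio (frac x).2 1)) by unlock FracField.tofrac.
have -> : FracField.tofrac (frac x).1 =
    (\pi_({fraction A})%qT (Ratio (frac x).1 1)) by unlock FracField.tofrac.
rewrite -[LHS]FracField.pi_mul; apply/eqmodP; rewrite /= FracField.equivfE.
rewrite /FracField.mulf !numden_Ratio ?mulr1 ?oner_eq0 ?denom_ratioP //.
by rewrite mulrC.
Qed.

(* The local ring at the point (a, b) of the plane affine curve over k with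
   coordinate functions x, y in K: the quotients g(x, y) / h(x, y) with
   h(a, b) <> 0. *)
Definition plane_loc (k K : fieldType) (iota : {rmorphism k -> K})
  (x y : K) (a b : k) : set K :=
  [set s | exists g h : {poly {poly k}}, h.[a, b] != 0 /\
     s = (map_poly (map_poly iota) g).[x, y] /
         (map_poly (map_poly iota) h).[x, y]].

Section Curves.
Variables (k : numClosedFieldType) (t t' : k).

Definition rhsE (x : k) : k := x * (x - 1) * (x - t).
Definition onE (p : k * k) : bool := p.2 ^+ 2 == rhsE p.1.

Definition rhsC : {poly k} :=
  (t'%:P - 'X^2) * ((t' - 1)%:P - 'X^2) * ((t' - t)%:P - 'X^2).
Definition onC (p : k * k) : bool := p.2 ^+ 2 == rhsC.[p.1].

(* None is the point at infinity. *)
Definition affE : choiceType := {p : k * k | onE p}.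
Definition ptE : choiceType := option affE.

(* In the chart u = 1/xi, w = y/xi^3 the curve C is
   w^2 = (t' u^2 - 1) ((t' - 1) u^2 - 1) ((t' - t) u^2 - 1); the points at
   infinity are those with u = 0, hence w^2 = -1. *)
Definition affC : choiceType := {p : k * k | onC p}.
Definition infC : choiceType := {w : k | w ^+ 2 == -1}.
Definition ptC : choiceType := (affC + infC)%type.

Definition mk_ptC (a b : k) (h : onC (a, b)) : ptC :=
  inl (exist (fun p => is_true (onC p)) (a, b) h).

Fact inf_plusP : 'i ^+ 2 == -1 :> k. Proof. by rewrite sqrCi. Qed.
Fact inf_minusP : (- 'i) ^+ 2 == -1 :> k. Proof. by rewrite sqrrN sqrCi. Qed.
Definition inf_plus : ptC := inr (exist (fun w => is_true (w ^+ 2 == -1)) 'i inf_plusP).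
Definition inf_minus : ptC :=
  inr (exist (fun w => is_true (w ^+ 2 == -1)) (- 'i) inf_minusP).

Fact onC_onE (p : k * k) : onC p -> onE (t' - p.1 ^+ 2, p.2).
Proof.
by rewrite /onC /onE /rhsC /rhsE !hornerE /= => /eqP ->; apply/eqP; ring.
Qed.

Definition mapf_aff (p : affC) : affE :=
  exist (fun p => is_true (onE p)) (t' - (val p).1 ^+ 2, (val p).2)
    (onC_onE (valP p)).

Definition mapf (p : ptC) : ptE :=
  match p with inl q => Some (mapf_aff q) | inr _ => None end.

Definition kxi : fieldType := {fraction {poly k}}.
Definition minpoly_y : {poly kxi} := 'X^2 - (FracField.tofrac rhsC)%:P.

Hypothesis ht : [&& t != 0, t != 1, t' != 0, t' != 1 & t != t'].

Fact rhsC_nonsquare (z : kxi) : z ^+ 2 <> FracField.tofrac rhsC.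
Proof.
have /and5P[t0 _ t'0 _ _] := ht.
have [n [d [d0 zE]]] := frac_numden z.
move=> z2.
have E : n ^+ 2 = rhsC * d ^+ 2.
  apply/eqP; rewrite -tofrac_eq rmorphXn rmorphM rmorphXn /= -zE -z2.
  by rewrite exprMn.
pose r := sqrtC t'; have r2 : r ^+ 2 = t' by rewrite sqrtCK.
pose c : {poly k} := (r%:P + 'X) * (((t' - 1)%:P - 'X^2) * ((t' - t)%:P - 'X^2)).
have rhsE : rhsC = - ('X - r%:P) * c.
  rewrite /rhsC /c -[X in (X%:P - 'X^2) * _ * _]r2 rmorphXn /=; ring.
have r0 : r != 0 by rewrite sqrtC_eq0.
have cr : ~~ root c r.
  rewrite /root /c !hornerE /= r2 !mulf_eq0 !negb_or -andbA.
  apply/and3P; split.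
  - by rewrite -mulr2n mulrn_eq0.
  - by rewrite addrAC subrr add0r oppr_eq0 oner_eq0.
  - by rewrite addrAC subrr add0r oppr_eq0.
have c0 : c != 0 by apply: contraNneq cr => ->; rewrite root0.
have n0 : n != 0.
  rewrite -sqrf_eq0 E mulf_neq0 ?sqrf_eq0 // rhsE mulf_neq0 //.
  by rewrite oppr_eq0 polyXsubC_eq0.
have := congr1 (mup r) E.
rewrite rhsE mulNr -mulrN -mulrA !expr2 !mupM ?mulf_neq0 ?oppr_eq0 ?polyXsubC_eq0 //.
rewrite (mupNroot (q := - c)) ?rootN // -['X - _]expr1 mup_XsubCX eqxx.
by move/(congr1 odd); rewrite !addnn /= add0n !odd_double.
Qed.

Fact irr_y : monic_irreducible_poly minpoly_y.
Proof.
have sz : size minpoly_y = 3 by rewrite /minpoly_y size_XnsubC.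
split; last by rewrite /minpoly_y monicXnsubC.
apply: cubic_irreducible; first by rewrite sz.
move=> z; apply/negP => /rootP; rewrite /minpoly_y !hornerE => /eqP.
by rewrite subr_eq0 => /eqP /rhsC_nonsquare.
Qed.

(* k(C) = k(xi)[y] / (y^2 - rhsC(xi)). *)
Definition kC : fieldType := {poly %/ minpoly_y with irr_y}.

Definition kC_of_kxi : {rmorphism kxi -> kC} := qpolyC minpoly_y.
Definition kC_of_k : {rmorphism k -> kC} :=
  kC_of_kxi \o (@FracField.tofrac {poly k}) \o polyC.

Definition xiC : kC := kC_of_kxi (FracField.tofrac 'X).
Definition yC : kC := qpolyX minpoly_y.
(* f^* x and f^* y: they satisfy the equation of E and generate f^* k(E). *)
Definition xE : kC := kC_of_k t' - xiC ^+ 2.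
Definition yE : kC := yC.

Definition curveC : curve kC := @Curve kC ptC (fun p =>
  match p with
  | inl q => plane_loc kC_of_k xiC yC (val q).1 (val q).2
  | inr w => plane_loc kC_of_k xiC^-1 (yC / xiC ^+ 3) 0 (val w)
  end).

(* At infinity, the chart (x/y, 1/y) of the plane cubic, with origin the point
   at infinity. *)
Definition curveE : curve kC := @Curve kC ptE (fun p =>
  match p with
  | Some q => plane_loc kC_of_k xE yE (val q).1 (val q).2
  | None => plane_loc kC_of_k (xE / yE) yE^-1 0 0
  end).

Definition fCE : curveC -> curveE := mapf.

Definition infE : curveE := None.

(* The germ with coordinates v in the basis (1, xi). *)
Definition germ (v : 'cV[k]_2) : kC :=
  kC_of_k (v ord0 ord0) * 1 + kC_of_k (v ord_max ord0) * xiC.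

End Curves.

Definition v2 (k : fieldType) (xi : k) : 'cV[k]_2 :=
  \col_(i < 2) nth 0 [:: xi; 1] i.

Definition Mxi (k : fieldType) (xi : k) : 'M[k]_2 :=
  \matrix_(i < 2, j < 2)
    nth 0 (nth [::] [:: [:: 1 / 2; xi / 2]; [:: 1 / (2 * xi); 1 / 2]] i) j.

Definition eigenvector (k : fieldType) n (A : 'M[k]_n) (a : k) (v : 'cV[k]_n) :=
  v != 0 /\ A *m v = a *: v.

(* Main.v *)
(* At an affine point q of E away from the branch points of f the stalk of E_0
   consists of the functions on C regular at both points (xi_0, y_0) and
   (- xi_0, y_0) of the fibre, and it is free over the local ring of E on
   xi_0 + xi and 1.  The section xi_0 + xi, with coordinate vector v_2, vanishes
   at (- xi_0, y_0) and not at (xi_0, y_0).  As f is unramified there, dividing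
   it by a local parameter of E creates a simple pole at (xi_0, y_0) and no
   other, so the elementary transform is f_* of the sheaf with a pole allowed at
   (xi_0, y_0).  At infinity f is unramified too, so twisting by - infinity on E
   amounts to requiring a zero at both points at infinity of C. *)

Require Import Defs.
From mathcomp Require Import all_boot all_order all_algebra.
From mathcomp Require Import polyXY fraction qpoly qfpoly.
From mathcomp Require Import classical_sets boolp cardinality reals complex.
From mathcomp Require Import ring.

Set Implicit Arguments.
Unset Strict Implicit.
Unset Printing Implicit Defensive.

Import Order.TTheory GRing.Theory Num.Theory.
Import Pdiv.CommonRing Pdiv.RingMonic.
Local Open Scope classical_set_scope.
Local Open Scope ring_scope.

(** Every sheaf involved is given by a condition at each point, so the equality is tested point by
    point on E. The obstacle is that parameters, bases and germs occur in the definitions under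
    existential quantifiers, with no order function at hand. Local rings are therefore described by
    places, relations between a function and its value in k. As the divisors have coefficients -1, 0
    and 1 only, one property of a parameter is enough: it divides every function of value 0.

    Two points need real work. That 1 and xi span the functions regular on a fibre requires one
    denominator that is good at both points at once, and then a norm to bring it down to E. And a
    stalk coincides with the condition imposed at its point only when each function violates the
    conditions at finitely many points, whence the finiteness lemmas. The charts of E are never
    studied on their own: that their relations vanish at a point of E is inherited from a point of C
    above it. *)

(** * Evaluation of polynomials in two variables *)

Lemma poly2_ind (A : comNzRingType) (P : {poly {poly A}} -> Prop) :
  (forall c, P c%:P%:P) -> P 'X -> P 'X%:P ->
  (forall p q, P p -> P q -> P (p + q)) ->
  (forall p q, P p -> P q -> P (p * q)) -> forall p, P p.
Proof.
move=> PC PX PY PD PM; elim/poly_ind => [|p c IHp]; first exact: PC 0.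
apply: (PD); first exact: PM.
elim/poly_ind: c => [|q d IHq]; first exact: PC 0.
by rewrite polyCD polyCM; apply: (PD) => //; apply: (PM).
Qed.

Section Eval2.
Variables (A B : comNzRingType) (f : {rmorphism A -> B}).

Definition eval2 (x y : B) (g : {poly {poly A}}) : B :=
  (map_poly (map_poly f) g).[x, y].

Lemma eval2C x y c : eval2 x y c%:P%:P = f c.
Proof. by rewrite /eval2 !map_polyC /= !map_polyC /= !hornerE. Qed.

Lemma eval2X x y : eval2 x y 'X = x.
Proof. by rewrite /eval2 map_polyX !hornerE. Qed.

Lemma eval2Y x y : eval2 x y 'X%:P = y.
Proof. by rewrite /eval2 map_polyC /= map_polyX !hornerE. Qed.

Lemma eval2D x y g h : eval2 x y (g + h) = eval2 x y g + eval2 x y h.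
Proof. by rewrite /eval2 rmorphD /= !hornerD. Qed.

Lemma eval2M x y g h : eval2 x y (g * h) = eval2 x y g * eval2 x y h.
Proof. by rewrite /eval2 rmorphM /= !hornerM. Qed.

Lemma eval2N x y g : eval2 x y (- g) = - eval2 x y g.
Proof. by rewrite /eval2 rmorphN /= !hornerN. Qed.

Definition eval2E := (eval2D, eval2M, eval2N, eval2C, eval2X, eval2Y).

End Eval2.

(** Lets an identity proved for every coefficient morphism be read at a point (a, b) as well as in
    K. *)
Lemma eval2_id (A : comNzRingType) (a b : A) (g : {poly {poly A}}) :
  eval2 idfun a b g = g.[a, b].
Proof. by rewrite /eval2 map_poly_id // => p _; rewrite map_poly_id. Qed.

(** * Places and local rings of plane curves *)

Section Places.
Variables (k K : fieldType) (iota : {rmorphism k -> K}).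
Implicit Types (V W : K -> k -> Prop) (s u x y : K) (a b c : k).

(* [V s c] reads: s is regular at the place, with value c. *)
Record place V : Prop := Place {
  placeC : forall c, V (iota c) c;
  placeD : forall s c s' c', V s c -> V s' c' -> V (s + s') (c + c');
  placeM : forall s c s' c', V s c -> V s' c' -> V (s * s') (c * c');
  placeV : forall s c, V s c -> c != 0 -> V s^-1 c^-1;
  place0 : forall c, V 0 c -> c = 0 }.

Definition regular V : set K := [set s | exists c, V s c].

Section PlaceTheory.
Variables (V : K -> k -> Prop) (PV : place V).

Lemma placeN s c : V s c -> V (- s) (- c).
Proof.
by move=> Vs; rewrite -mulN1r -[- c]mulN1r -(rmorphN1 iota);
  apply: placeM => //; exact: placeC.
Qed.

Lemma placeB s c s' c' : V s c -> V s' c' -> V (s - s') (c - c').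
Proof. by move=> Vs Vs'; apply: placeD => //; exact: placeN. Qed.

Lemma place_inj s c c' : V s c -> V s c' -> c = c'.
Proof.
move=> Vc Vc'; apply/eqP; rewrite -subr_eq0; apply/eqP/(place0 PV).
by rewrite -(subrr s); exact: placeB.
Qed.

Lemma placeX s c n : V s c -> V (s ^+ n) (c ^+ n).
Proof.
move=> Vs; elim: n => [|n IHn]; last by rewrite !exprS; exact: placeM.
by rewrite !expr0 -(rmorph1 iota); exact: placeC.
Qed.

Lemma place_nz s c : V s c -> c != 0 -> s != 0.
Proof. by move=> Vs; apply: contra_neq => s0; apply: (place0 PV);
  rewrite -s0. Qed.

Lemma place_eval2 x y a b g : V x a -> V y b -> V (eval2 iota x y g) g.[a, b].
Proof.
move=> Vx Vy; elim/poly2_ind: g => [c|||p q IHp IHq|p q IHp IHq].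
- by rewrite eval2C !hornerC; exact: placeC.
- by rewrite eval2X hornerX hornerC.
- by rewrite eval2Y hornerC hornerX.
- by rewrite eval2D !hornerD; exact: placeD.
- by rewrite eval2M !hornerM; exact: placeM.
Qed.

Lemma regularC c : regular V (iota c). Proof. by exists c; exact: placeC. Qed.

Lemma regular1 : regular V 1.
Proof. by rewrite -(rmorph1 iota); exact: regularC. Qed.

Lemma regular0 : regular V 0.
Proof. by rewrite -(rmorph0 iota); exact: regularC. Qed.

Lemma regularD s s' : regular V s -> regular V s' -> regular V (s + s').
Proof. by move=> [c Vs] [c' Vs']; exists (c + c'); exact: placeD. Qed.

Lemma regularM s s' : regular V s -> regular V s' -> regular V (s * s').
Proof. by move=> [c Vs] [c' Vs']; exists (c * c'); exact: placeM. Qed.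

Lemma regularN s : regular V s -> regular V (- s).
Proof. by move=> [c Vs]; exists (- c); exact: placeN. Qed.

Lemma regularB s s' : regular V s -> regular V s' -> regular V (s - s').
Proof. by move=> Vs Vs'; apply: regularD => //; exact: regularN. Qed.

Lemma place_eq0M s s' : V s 0 -> regular V s' -> V (s * s') 0.
Proof. by move=> Vs [c Vs']; rewrite -(mul0r c); exact: placeM. Qed.

End PlaceTheory.

(** A generator of the maximal ideal, stated without valuations: a single division by u is all that
    coefficients -1, 0, 1 require. *)
Definition uniformizer V u :=
  [/\ u != 0, V u 0 & forall s, V s 0 -> regular V (s / u)].

Definition plane_val x y a b : K -> k -> Prop := fun s c =>
  exists g h, [/\ h.[a, b] != 0, s = eval2 iota x y g / eval2 iota x y h
                & c = g.[a, b] / h.[a, b]].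

(** The point (a, b) lies on the curve with generic point (x, y). This keeps a denominator that is
    nonzero at (a, b) nonzero in K; otherwise the quotients in [plane_val] could be divisions by
    0. *)
Definition centered x y a b :=
  forall h, eval2 iota x y h = 0 -> h.[a, b] = 0.

Lemma plane_locE x y a b : plane_loc iota x y a b = regular (plane_val x y a b).
Proof.
apply/seteqP; split=> s.
  by move=> [g [h [h0 ->]]]; exists (g.[a, b] / h.[a, b]), g, h.
by move=> [c [g [h [h0 -> _]]]]; exists g, h.
Qed.

Lemma plane_val_eval2 x y a b g : plane_val x y a b (eval2 iota x y g) g.[a, b].
Proof.
by exists g, 1; rewrite /eval2 !rmorph1 !hornerC !divr1 oner_neq0.
Qed.

Lemma plane_valX x y a b : plane_val x y a b x a.
Proof. by have := plane_val_eval2 x y a b 'X;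
  rewrite eval2X hornerX hornerC. Qed.

Lemma plane_valY x y a b : plane_val x y a b y b.
Proof. by have := plane_val_eval2 x y a b 'X%:P;
  rewrite eval2Y hornerC hornerX. Qed.

Lemma plane_place x y a b : centered x y a b -> place (plane_val x y a b).
Proof.
move=> cen; have nz h : h.[a, b] != 0 -> eval2 iota x y h != 0.
  by apply: contra_neq; exact: cen.
split.
- by move=> c; have := plane_val_eval2 x y a b c%:P%:P; rewrite eval2C !hornerC.
- move=> _ _ _ _ [g [h [h0 -> ->]]] [g' [h' [h0' -> ->]]].
  exists (g * h' + g' * h), (h * h').
  rewrite !hornerM !hornerD !hornerM !eval2E mulf_neq0 //.
  by split=> //; rewrite addf_div // nz.
- move=> _ _ _ _ [g [h [h0 -> ->]]] [g' [h' [h0' -> ->]]].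
  exists (g * g'), (h * h').
  by rewrite !hornerM !eval2E mulf_neq0 // !mulf_div.
- move=> _ _ [g [h [h0 -> ->]]]; rewrite mulf_eq0 negb_or => /andP[g0 _].
  by exists h, g; rewrite !invf_div.
- move=> c [g [h [h0 E ->]]]; rewrite cen ?mul0r //; apply/eqP.
  by have /esym/eqP := E; rewrite mulf_eq0 invr_eq0 (negbTE (nz _ h0)) orbF.
Qed.

(** Used to hand [centered] down from points of C to points of E, without describing the relations
    between x and y. *)
Lemma place_centered V x y a b : place V -> V x a -> V y b -> centered x y a b.
Proof.
move=> PV Vx Vy h h0; apply: (place0 PV); rewrite -h0; exact: place_eval2.
Qed.

Lemma plane_val_sub V x y a b : place V -> V x a -> V y b ->
  forall s c, plane_val x y a b s c -> V s c.
Proof.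
move=> PV Vx Vy s c [g [h [h0 -> ->]]].
by apply: placeM; [|exact: place_eval2|apply: placeV => //; exact: place_eval2].
Qed.

(** The maximal ideal at (a, b) is generated by x - a and y - b, so u needs to divide only these
    two. The divisibility of g(x, y) - g(a, b) by u passes to products through PQ - P'Q' = (P - P')Q
    + P'(Q - Q'). *)
Lemma plane_uniformizer x y a b u : centered x y a b ->
  let V := plane_val x y a b in
  u != 0 -> V u 0 -> regular V ((x - iota a) / u) ->
  regular V ((y - iota b) / u) -> uniformizer V u.
Proof.
move=> cen V u0 Vu Vx Vy; have PV := plane_place cen; split=> // s.
have main g : regular V ((eval2 iota x y g - iota g.[a, b]) / u).
  elim/poly2_ind: g => [c|||p q IHp IHq|p q IHp IHq].
  - by rewrite eval2C !hornerC subrr mul0r; exact: regular0.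
  - by rewrite eval2X hornerX hornerC.
  - by rewrite eval2Y hornerC hornerX.
  - rewrite eval2D !hornerD rmorphD opprD addrACA mulrDl; exact: regularD.
  - rewrite eval2M !hornerM rmorphM /=.
    set P := eval2 _ _ _ p in IHp *; set Q := eval2 _ _ _ q in IHq *.
    set P' := iota _ in IHp *; set Q' := iota _ in IHq *.
    have -> : (P * Q - P' * Q') / u = (P - P') / u * Q + P' * ((Q - Q') / u).
      by ring.
    apply: regularD => //; apply: regularM => //; last exact: regularC.
    by exists q.[a, b]; exact: plane_val_eval2.
move=> [g [h [h0 -> /esym/eqP]]].
rewrite mulf_eq0 invr_eq0 (negbTE h0) orbF => /eqP g0.
rewrite mulrAC; apply: regularM => //.
  by have := main g; rewrite g0 rmorph0 subr0.
by exists h.[a, b]^-1; apply: placeV => //; exact: plane_val_eval2.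
Qed.

End Places.
(** * The function field of C *)

Section QuadraticExtension.
Variables (F : fieldType) (h : {poly F}) (hI : monic_irreducible_poly h).
Hypothesis sz_h : size h = 3.
Local Notation L := {poly %/ h with hI}.
Local Notation C := (qpolyC h : F -> L).

Lemma qfpoly_deg1E (a b : F) : (C a + C b * qpolyX h : L) = in_qpoly h (a%:P +
  b%:P * 'X).
Proof.
rewrite rmorphD rmorphM /=; congr (_ + _ * _); apply: val_inj => /=;
by rewrite rmodp_small // size_polyC (leq_ltn_trans _ (size_mk_monic_gt1 h))
  //; case: eqP.
Qed.

Lemma size_deg1 (a b : F) : (size (a%:P + b%:P * 'X)%R <= 2)%N.
Proof.
rewrite addrC size_MXaddC size_polyC; case: ifP => // _.
by rewrite ltnS; case: (b != 0).
Qed.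

Lemma qfpoly_free (a b : F) : C a + C b * qpolyX h = 0 :> L -> a = 0 /\ b = 0.
Proof.
rewrite qfpoly_deg1E => /(congr1 (fun s : {poly %/ h} => s : {poly F})).
rewrite in_qpoly_small; last first.
  by apply: leq_ltn_trans (size_deg1 _ _) _; rewrite (mk_monicE hI) sz_h.
move=> /polyP /= E; have := E 0; have := E 1.
by rewrite !coefD !coefCM !coefC !coefX /= mulr0 addr0 mulr1 add0r => -> ->.
Qed.

Lemma qfpoly_span (s : L) : exists a b, s = C a + C b * qpolyX h.
Proof.
exists (val s)`_0, (val s)`_1; rewrite qfpoly_deg1E;
  apply: (val_inj : injective (fun s : {poly %/ h} => s : {poly F})).
rewrite in_qpoly_small; last first.
  by apply: leq_ltn_trans (size_deg1 _ _) _; rewrite (mk_monicE hI) sz_h.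
have sz_s : (size (val s) <= 2)%N.
  by have := size_mk_monic s;
    rewrite [in X in (_ < X)%N -> _](mk_monicE hI) sz_h.
apply/polyP => -[|[|i]]; rewrite !coefD !coefCM !coefC !coefX /=.
- by rewrite mulr0 addr0.
- by rewrite mulr1 add0r.
- by rewrite mulr0 addr0 nth_default // (leq_trans sz_s).
Qed.

End QuadraticExtension.

Section FunctionFieldC.
Variables (k : numClosedFieldType) (t t' : k).
Variable ht : [&& t != 0, t != 1, t' != 0, t' != 1 & t != t'].
Local Notation emb := (kC_of_kxi ht).

Lemma size_minpoly_y : size (minpoly_y t t') = 3.
Proof. by rewrite size_XnsubC. Qed.

Lemma kC_free (a b : kxi k) : emb a + emb b * yC ht = 0 -> a = 0 /\ b = 0.
Proof. exact: (@qfpoly_free _ _ (irr_y ht) size_minpoly_y). Qed.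

Lemma kC_span (s : kC ht) : exists a b, s = emb a + emb b * yC ht.
Proof. exact: (@qfpoly_span _ _ (irr_y ht) size_minpoly_y). Qed.

Lemma yC_sqr : yC ht ^+ 2 = emb (FracField.tofrac (rhsC t t')).
Proof.
apply/eqP; rewrite -subr_eq0; apply/eqP.
have -> : emb (FracField.tofrac (rhsC t t')) = in_qpoly (minpoly_y t t')
  (FracField.tofrac (rhsC t t'))%:P :> kC ht.
  apply: val_inj => /=; rewrite rmodp_small // (mk_monicE (irr_y ht)).
  by rewrite size_minpoly_y size_polyC; case: eqP.
rewrite /yC /qpolyX -rmorphXn -rmorphB -/(minpoly_y t t').
apply: val_inj => /=; rewrite (mk_monicE (irr_y ht)).
by rewrite -[X in rmodp X _]mul1r rmodp_mull ?(irr_y ht).2.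
Qed.

End FunctionFieldC.

Section FunctionField.
Variables (k : numClosedFieldType) (t t' : k).
Variables (K : fieldType) (emb : {rmorphism kxi k -> K}) (y : K).
Local Notation R := (rhsC t t').
Local Notation frac := (@FracField.tofrac {poly k}).
Hypothesis y_free : forall a b, emb a + emb b * y = 0 -> a = 0 /\ b = 0.
Hypothesis y_span : forall s, exists a b, s = emb a + emb b * y.
Hypothesis y_sqr : y ^+ 2 = emb (frac R).

Let iota : {rmorphism k -> K} := emb \o (@FracField.tofrac {poly k}) \o polyC.
Let xi : K := emb (FracField.tofrac 'X).
Let x : K := iota t' - xi ^+ 2.

Lemma horner_xi (p : {poly k}) : (map_poly iota p).[xi] = emb (frac p).
Proof.
have -> : map_poly iota p = map_poly emb (map_poly frac p^:P).
  by rewrite -!map_poly_comp.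
by rewrite /xi !horner_map -/(p \Po 'X) comp_polyXr.
Qed.

Lemma xi_free (p q : {poly k}) :
  (map_poly iota p).[xi] + (map_poly iota q).[xi] * y = 0 -> p = 0 /\ q = 0.
Proof.
rewrite !horner_xi => /y_free[/eqP + /eqP]; rewrite !tofrac_eq0.
by move=> /eqP-> /eqP->.
Qed.

(** The factor xi^-3 is a nonzero element of k(xi), so the independence of 1 and y over k(xi)
    applies; it remains that 1/xi is transcendental, which holds because the inverse of an algebraic
    element is algebraic. *)
Lemma xi_inv_free (p q : {poly k}) :
  (map_poly iota p).[xi^-1] + (map_poly iota q).[xi^-1] * (y / xi ^+ 3) = 0 ->
  p = 0 /\ q = 0.
Proof.
have trans (r : {poly k}) : (map_poly iota r).[xi^-1] = 0 -> r = 0.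
  move=> r0; apply/eqP; apply: contraT => rn0.
  have /algebraic_inv[u un0] : algebraicOver iota xi^-1.
    by exists r => //; apply/rootP.
  rewrite invrK => /rootP u0.
  have [|u00 _] := @xi_free u 0;
    first by rewrite u0 rmorph0 horner0 mul0r addr0.
  by rewrite u00 eqxx in un0.
have xiE : xi^-1 = emb (frac 'X)^-1 by rewrite fmorphV.
have frE (r : {poly k}) : (map_poly iota r).[xi^-1] =
    emb (map_poly frac r^:P).[(frac 'X)^-1].
  by rewrite xiE -horner_map -!map_poly_comp.
have -> : y / xi ^+ 3 = emb ((frac 'X) ^+ 3)^-1 * y.
  by rewrite fmorphV rmorphXn mulrC.
rewrite !frE mulrA -(rmorphM emb) => /y_free[E1 /eqP].
rewrite mulf_eq0 invr_eq0 expf_eq0 tofrac_eq0 polyX_eq0 orbF.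
move=> /eqP E2; split; apply: trans; rewrite frE ?E1 ?E2 rmorph0 //.
Qed.

(** Serves to bound poles: away from infinity, s can fail to be regular only over the roots of d. *)
Lemma ff_frac s : exists p q d : {poly k}, d != 0 /\
  s = ((map_poly iota p).[xi] + (map_poly iota q).[xi] * y) /
      (map_poly iota d).[xi].
Proof.
have [a [b ->]] := y_span s.
have [n [d [d0 aE]]] := frac_numden a; have [m [e [e0 bE]]] := frac_numden b.
exists (n * e), (m * d), (d * e); split; first by rewrite mulf_neq0.
have de0 : emb (frac (d * e)) != 0 by rewrite fmorph_eq0 tofrac_eq0 mulf_neq0.
apply: (canRL (mulfK _)); rewrite !horner_xi // !rmorphM /= -aE -bE !rmorphM /=.
ring.
Qed.

Lemma y_eq : y ^+ 2 = (map_poly iota R).[xi].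
Proof. by rewrite y_sqr horner_xi. Qed.

End FunctionField.

(** * Charts y^2 = R(x) *)

Section Chart.
Variables (A B : comNzRingType) (f : {rmorphism A -> B}).

Lemma eval2_polyX (x y : B) (p : {poly A}) :
  eval2 f x y p^:P = (map_poly f p).[x].
Proof.
rewrite /eval2 -map_poly_comp (eq_map_poly (map_polyC f)).
by rewrite (map_poly_comp polyC f) horner_map /= hornerC.
Qed.

(** Reduction modulo y^2 - R. The polynomials p and q are chosen before the ring and the morphism,
    so the same pair serves in K and at a point of the curve. *)
Lemma chart_reduce (R : {poly A}) g : exists p q : {poly A},
  forall (C : comNzRingType) (f : {rmorphism A -> C}) x y,
    y ^+ 2 = (map_poly f R).[x] ->
    eval2 f x y g = (map_poly f p).[x] + (map_poly f q).[x] * y.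
Proof.
elim/poly2_ind: g => [c|||g h [p [q IHp]] [p' [q' IHp']]|g h [p [q IHp]] [p'
  [q' IHp']]].
- exists c%:P, 0 => C j x y _.
  by rewrite eval2C map_polyC hornerC rmorph0 horner0 mul0r addr0.
- exists 'X, 0 => C j x y _.
  by rewrite eval2X map_polyX hornerX rmorph0 horner0 mul0r addr0.
- exists 0, 1 => C j x y _.
  by rewrite eval2Y rmorph0 horner0 add0r rmorph1 hornerC mul1r.
- exists (p + p'), (q + q') => C j x y e.
  by rewrite eval2D IHp // IHp' // !rmorphD !hornerD mulrDl addrACA.
- exists (p * p' + q * q' * R), (p * q' + q * p') => C j x y e.
  rewrite eval2M IHp // IHp' // !(rmorphD, rmorphM) /= !(hornerD, hornerM) -e.
  ring.
Qed.

End Chart.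

Lemma root_factor (A : comNzRingType) (P : {poly A}) (a : A) :
  P.[a] = 0 -> exists2 S, P = S * ('X - a%:P) & S.[a] = P^`().[a].
Proof.
move=> /rootP/factor_theorem[S ->]; exists S => //.
by rewrite derivM derivXsubC mulr1 !hornerE subrr mulr0 add0r.
Qed.

Section ChartPlace.
Variables (k K : fieldType) (iota : {rmorphism k -> K}).
Variables (x y : K) (R : {poly k}) (a b : k).
Hypotheses (y2 : y ^+ 2 = (map_poly iota R).[x]) (b2 : b ^+ 2 = R.[a]).
Local Notation V := (plane_val iota x y a b).

(** A relation reduces to p(x) + q(x) y = 0, hence p = q = 0 by independence, and the same p and q
    compute its value at (a, b). *)
Lemma chart_centered :
  (forall p q : {poly k}, (map_poly iota p).[x] + (map_poly iota q).[x] * y = 0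
    ->
     p = 0 /\ q = 0) -> centered iota x y a b.
Proof.
move=> free h; have [p [q red]] := chart_reduce R h.
rewrite (red _ _ _ _ y2) -eval2_id => /free[p0 q0].
rewrite (red _ idfun a b); last by rewrite map_poly_id.
by rewrite p0 q0 !rmorph0 !horner0 mul0r addr0.
Qed.

Hypothesis cen : centered iota x y a b.

Lemma place_horner (W : K -> k -> Prop) (p : {poly k}) s c :
  place iota W -> W s c -> W (map_poly iota p).[s] p.[c].
Proof.
move=> PW Ws; have := place_eval2 PW p^:P Ws (placeC PW 0).
by rewrite eval2_polyX horner_map /= hornerC.
Qed.

(** Where b is nonzero, (y - b)/(x - a) = S(x)/(y + b) with S = (R - R(a))/(X - a), and y + b has
    the nonzero value 2b. *)
Lemma chart_uniformizer_x :
  b + b != 0 -> x - iota a != 0 -> uniformizer V (x - iota a).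
Proof.
move=> bb xa; have PV := plane_place cen.
have Vx : V x a := plane_valX _ _ _ _ _.
have Vy : V y b := plane_valY _ _ _ _ _.
have [|S SE _] := @root_factor _ (R - R.[a]%:P) a;
  first by rewrite !hornerE subrr.
have Vyb : V (y + iota b) (b + b) by apply: (placeD PV) => //;
  exact: (placeC PV).
have yb : y + iota b != 0 := place_nz PV Vyb bb.
apply: plane_uniformizer => //.
- by rewrite -[X in V _ X](subrr a); apply: (placeB PV) => //;
    exact: (placeC PV).
- by rewrite divff //; exact: (regular1 PV).
have -> : (y - iota b) / (x - iota a) = (map_poly iota S).[x] / (y + iota b).
  apply/eqP; rewrite eqr_div // -subr_sqr -rmorphXn b2 y2; apply/eqP.
  have := congr1 (fun p => (map_poly iota p).[x]) SE.
  rewrite rmorphM !rmorphB /= !map_polyC map_polyX /= !(hornerM, hornerD,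
    hornerN, hornerC, hornerX).
  by [].
exists (S.[a] / (b + b)); apply: (placeM PV) => //;
  first exact: (place_horner _ PV).
exact: (placeV PV).
Qed.

(** At a simple root a of R, write R = S (X - a); then (x - a)/y = y/S(x), and S(a) = R'(a) is
    nonzero. *)
Lemma chart_uniformizer_y :
  b = 0 -> R^`().[a] != 0 -> y != 0 -> uniformizer V y.
Proof.
move=> b0 Ra y0; have PV := plane_place cen.
have Vx : V x a := plane_valX _ _ _ _ _.
have Vy : V y b := plane_valY _ _ _ _ _.
have [|S SE Sa] := @root_factor _ R a; first by rewrite -b2 b0 expr0n.
have VS : V (map_poly iota S).[x] R^`().[a] by rewrite -Sa;
  exact: (place_horner _ PV).
have S0 := place_nz PV VS Ra.
apply: plane_uniformizer => //; first by rewrite -b0.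
- have -> : (x - iota a) / y = y / (map_poly iota S).[x].
    apply/eqP; rewrite eqr_div // -expr2 y2 SE rmorphM rmorphB /= map_polyC
      map_polyX /=.
    by rewrite !(hornerM, hornerD, hornerN, hornerC, hornerX) mulrC.
  by exists (b / R^`().[a]); apply: (placeM PV) => //; exact: (placeV PV).
- by rewrite [X in iota X]b0 rmorph0 subr0 divff //; exact: (regular1 PV).
Qed.

End ChartPlace.

Section Uniformizers.
Variables (k K : fieldType) (iota : {rmorphism k -> K}).
Variables (V W : K -> k -> Prop).
Hypotheses (PV : place iota V) (PW : place iota W).

Lemma uniformizerM u s c :
  uniformizer V u -> V s c -> c != 0 -> uniformizer V (u * s).
Proof.
move=> [u0 Vu uP] Vs c0; split.
- by rewrite mulf_neq0 // (place_nz PV Vs).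
- by apply: (place_eq0M PV) => //; exists c.
move=> r Vr; rewrite invfM mulrA; apply: (regularM PV) => //; first exact: uP.
by exists c^-1; apply: (placeV PV).
Qed.

(** One common uniformizer u shows that W is unramified over V: in s/v = (s/u)(u/v) the second
    factor is already regular at V. *)
Lemma uniformizer_dominated u v : (forall s c, V s c -> W s c) ->
  uniformizer V u -> uniformizer W u -> uniformizer V v ->
  uniformizer W v.
Proof.
move=> VW [u0 Vu uV] [_ _ uW] [v0 Vv vV]; split=> //; first exact: VW.
move=> s /uW su; have [c /VW uv] := vV _ Vu.
have -> : s / v = s / u * (u / v) by rewrite mulrA mulfVK.
by apply: (regularM PW) => //; exists c.
Qed.

End Uniformizers.

(** * Sheaves given by conditions at each point *)

Section PointwiseSheaf.
Variables (k K : fieldType) (iota : {rmorphism k -> K}) (X : curve K).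

Definition pointwise (P : X -> set K) : subsheaf X :=
  fun U => [set s | forall r, U r -> P r s].

Lemma stalk_pointwise_sub (P : X -> set K) p : stalk (pointwise P) p `<=` P p.
Proof. by move=> s [U [_ Up Us]]; exact: Us. Qed.

(** The finiteness makes the set of points where s satisfies the condition open, and s is a section
    over it. *)
Lemma stalk_pointwise (P : X -> set K) p :
  (forall s, finite_set [set r | ~ P r s]) -> stalk (pointwise P) p = P p.
Proof.
move=> fin; apply/seteqP; split; first exact: stalk_pointwise_sub.
by move=> s Ps; exists [set r | P r s]; split => //; exact: fin.
Qed.

Definition elm_at (q : X) v (F : subsheaf X) r : set K :=
  [set s | if r == q then
    exists tau e1 e2, [/\ local_param q tau, local_basis F q e1 e2,
      same_fiber F q e1 v & span2 q (tau^-1 * e1) e2 s]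
  else stalk F r s].

Lemma elmE (q : X) v (F : subsheaf X) : elm q v F = pointwise (elm_at q v F).
Proof. by []. Qed.

Lemma elm_at_neq (q : X) v (F : subsheaf X) r :
  r != q -> elm_at q v F r = stalk F r.
Proof. by rewrite /elm_at => /negbTE ->. Qed.

Lemma stalk_elm (q : X) v (F : subsheaf X) r :
  (forall s, finite_set [set r | ~ stalk F r s]) ->
  stalk (elm q v F) r = elm_at q v F r.
Proof.
move=> fin; rewrite elmE; apply: stalk_pointwise => s.
apply: (sub_finite_set (B := [set q] `|` [set r | ~ stalk F r s])).
  move=> r' /=; case: (eqVneq r' q) => [->|r'q]; first by left.
  by rewrite elm_at_neq //; right.
by rewrite finite_setU; split; [exact: finite_set1|exact: fin].
Qed.

Definition div_regular (D : X -> int) (p : X) : set K :=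
  [set s | exists tau, local_param p tau /\ loc p (tau ^ D p * s)].

Lemma div_regular0 (D : X -> int) p s : (exists tau, local_param p tau) ->
  D p = 0 -> div_regular D p s <-> loc p s.
Proof.
move=> [tau0 tauP] Dp; rewrite /div_regular /= Dp; split.
  by move=> [tau [_]]; rewrite expr0z mul1r.
by move=> rs; exists tau0; rewrite expr0z mul1r.
Qed.

Lemma mod_prod_sub (A B C : set K) : C 0 ->
  (forall a b, C a -> C b -> C (a + b)) ->
  (forall a b, A a -> B b -> C (a * b)) -> mod_prod A B `<=` C.
Proof.
move=> C0 CD CM s [n [a [b [ab ->]]]].
by elim/big_ind: _ => // i _; have [] := ab i; exact: CM.
Qed.

Lemma mod_prodM (A B : set K) a b : A a -> B b -> mod_prod A B (a * b).
Proof.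
move=> Aa Bb; exists 1, (fun=> a), (fun=> b); split=> //.
by rewrite big_ord1.
Qed.

Lemma mod_prod0 (A B : set K) : mod_prod A B 0.
Proof. by exists 0, (fun=> 0), (fun=> 0); split=> [[]|] //;
  rewrite big_ord0. Qed.

Variables (p : X) (V : K -> k -> Prop).
Hypotheses (PV : place iota V) (locV : loc p = regular V).

Lemma max_idealE : max_ideal p = [set s | V s 0].
Proof.
apply/seteqP; split=> s /=.
  move=> [+ nu]; rewrite locV => -[c Vs].
  have [c0|c0] := eqVneq c 0; first by rewrite -c0.
  case: nu; split; first exact: (place_nz PV Vs).
  by rewrite locV; exists c^-1; exact: (placeV PV).
move=> Vs; rewrite /max_ideal /= locV; split; first by exists 0.
move=> [s0 [c Vsi]].
have := placeM PV Vs Vsi; rewrite mul0r divff // -(rmorph1 iota) => V1.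
by have /eqP := place_inj PV V1 (placeC PV 1); rewrite eq_sym oner_eq0.
Qed.

Lemma local_paramP tau : local_param p tau <-> uniformizer V tau.
Proof.
rewrite /local_param max_idealE locV; split.
  move=> [tau0 /seteqP[sub sup]]; split=> //.
    by apply: sup; exists 1; rewrite ?mulr1 //; exact: (regular1 PV).
  by move=> s /sub[a Va <-]; rewrite mulrAC divff // mul1r.
move=> [tau0 Vtau tauP]; split=> //; apply/seteqP; split=> s /=.
  by move=> /tauP Vs; exists (s / tau) => //; rewrite mulrC mulfVK.
by move=> [a Va <-]; apply: (place_eq0M PV).
Qed.

End PointwiseSheaf.

(* K and the coordinates xi, y are kept abstract: in the concrete kC,
   unification would unfold the arithmetic of the quotient ring.  Besides
   the independence of 1 and y (resp. y / xi^3) over k(xi), the first two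
   hypotheses say that xi is transcendental over k. *)
Section CurveModel.
Variables (k : numClosedFieldType) (t t' : k).
Variables (K : fieldType) (iota : {rmorphism k -> K}) (xi y : K).
Local Notation R := (rhsC t t').
Hypothesis ht : [&& t != 0, t != 1, t' != 0, t' != 1 & t != t'].
Hypothesis xi_free : forall p q : {poly k},
  (map_poly iota p).[xi] + (map_poly iota q).[xi] * y = 0 -> p = 0 /\ q = 0.
Hypothesis xi_inv_free : forall p q : {poly k},
  (map_poly iota p).[xi^-1] + (map_poly iota q).[xi^-1] * (y / xi ^+ 3) = 0 ->
  p = 0 /\ q = 0.
Hypothesis ff_frac : forall s, exists p q d : {poly k}, d != 0 /\
  s = ((map_poly iota p).[xi] + (map_poly iota q).[xi] * y) /
      (map_poly iota d).[xi].
Hypothesis y_eq : y ^+ 2 = (map_poly iota R).[xi].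

Let x : K := iota t' - xi ^+ 2.

Lemma xi_neq (a : k) : xi - iota a != 0.
Proof.
apply/eqP => E; have [|+ _] := @xi_free ('X - a%:P) 0.
  by rewrite rmorph0 horner0 mul0r addr0 rmorphB /= map_polyX map_polyC
    !hornerE.
by move/eqP; rewrite polyXsubC_eq0.
Qed.

Lemma xi_neq0 : xi != 0.
Proof. by have := xi_neq 0; rewrite rmorph0 subr0. Qed.

Lemma y_neq0 : y != 0.
Proof.
apply/eqP => E; have [|_ /eqP] := @xi_free 0 1; last by rewrite oner_eq0.
by rewrite rmorph0 horner0 add0r E mulr0.
Qed.

(** This is X^6 R(1/X), the right-hand side in the chart u = 1/xi, w = y/xi^3; its value -1 at 0
    gives the equation of [infC]. *)
Definition rhsCinf : {poly k} :=
  (t'%:P * 'X^2 - 1) * ((t' - 1)%:P * 'X^2 - 1) * ((t' - t)%:P * 'X^2 - 1).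

Lemma w_eq : (y / xi ^+ 3) ^+ 2 = (map_poly iota rhsCinf).[xi^-1].
Proof.
rewrite expr_div_n y_eq /rhsC /rhsCinf.
rewrite !(rmorphM, rmorphB, rmorphXn, rmorph1) /= !map_polyC !map_polyX /=
  !hornerE.
by rewrite /=; field; exact: xi_neq0.
Qed.

Lemma xE_yE_eq : y ^+ 2 = x * (x - 1) * (x - iota t).
Proof.
rewrite y_eq /rhsC /x.
rewrite !(rmorphM, rmorphB, rmorphXn, rmorph1) /= !map_polyC !map_polyX /=
  !hornerE.
by ring.
Qed.

Local Notation u := xi^-1.
Local Notation w := (y / xi ^+ 3).

(** The parameter x/y of E at infinity is u times a factor of value -1/w, a unit at each point of C
    above; f is thus unramified there. *)
Lemma z_eq : x / y = u * ((iota t' * u ^+ 2 - 1) / w).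
Proof. by rewrite /x; field; rewrite y_neq0 xi_neq0. Qed.

Lemma y_inv_eq : y^-1 = u ^+ 3 / w.
Proof. by field; rewrite y_neq0 xi_neq0. Qed.

(** * The places of C and E *)

Definition valC (p : ptC t t') : K -> k -> Prop :=
  match p with
  | inl q => plane_val iota xi y (val q).1 (val q).2
  | inr v => plane_val iota u w 0 (val v)
  end.

Definition valE (r : ptE t) : K -> k -> Prop :=
  match r with
  | Some q => plane_val iota x y (val q).1 (val q).2
  | None => plane_val iota (x / y) y^-1 0 0
  end.

Lemma infC_sqr (v : infC k) : val v ^+ 2 = rhsCinf.[0].
Proof.
rewrite (eqP (valP v)) /rhsCinf !(hornerM, hornerD, hornerN, hornerC).
by rewrite !hornerX; ring.
Qed.

Lemma affC_centered (q : affC t t') : centered iota xi y (val q).1 (val q).2.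
Proof. exact: chart_centered y_eq (eqP (valP q)) xi_free. Qed.

Lemma infC_centered (v : infC k) : centered iota u w 0 (val v).
Proof. exact: chart_centered w_eq (infC_sqr v) xi_inv_free. Qed.

Lemma valC_place p : place iota (valC p).
Proof.
by case: p => [q|v]; apply: plane_place;
  [exact: affC_centered|exact: infC_centered].
Qed.

Lemma infC_neq0 (v : infC k) : val v != 0.
Proof. by rewrite -sqrf_eq0 (eqP (valP v)) oppr_eq0 oner_eq0. Qed.

Lemma valC_xi (q : affC t t') : valC (inl q) xi (val q).1.
Proof. exact: plane_valX. Qed.

Lemma valC_x (q : affC t t') : valC (inl q) x (val (mapf_aff q)).1.
Proof.
have P := valC_place (inl q); apply: (placeB P); first exact: (placeC P).
exact: (placeX P _ (valC_xi q)).
Qed.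

Lemma valC_y (q : affC t t') : valC (inl q) y (val (mapf_aff q)).2.
Proof. exact: plane_valY. Qed.

Lemma valC_zcoef (v : infC k) :
  valC (inr v) ((iota t' * u ^+ 2 - 1) / w) (- (val v)^-1).
Proof.
have P := valC_place (inr v).
have Vu : valC (inr v) u 0 := plane_valX _ _ _ _ _.
have Vw : valC (inr v) w (val v) := plane_valY _ _ _ _ _.
rewrite -[- (val v)^-1]mulN1r; apply: (placeM P);
  last exact: (placeV P Vw (infC_neq0 v)).
have -> : -1 = t' * 0 ^+ 2 - 1 by rewrite expr0n mulr0 add0r.
apply: (placeB P); last by rewrite -(rmorph1 iota); exact: (placeC P).
by apply: (placeM P); [exact: (placeC P)|exact: (placeX P)].
Qed.

Lemma valC_z (v : infC k) : valC (inr v) (x / y) 0.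
Proof.
have P := valC_place (inr v); rewrite z_eq; apply: (place_eq0M P).
  exact: plane_valX.
by exists (- (val v)^-1); exact: valC_zcoef.
Qed.

Lemma valC_yinv (v : infC k) : valC (inr v) y^-1 0.
Proof.
have P := valC_place (inr v); rewrite y_inv_eq; apply: (place_eq0M P).
  have <- : 0 ^+ 3 = 0 :> k by rewrite expr0n.
  by apply: (placeX P); exact: plane_valX.
by exists (val v)^-1; apply: (placeV P); [exact: plane_valY|exact: infC_neq0].
Qed.

Lemma valE_dominated p s c : valE (mapf p) s c -> valC p s c.
Proof.
case: p => [q|v]; apply: (plane_val_sub (valC_place _)).
- exact: valC_x.
- exact: valC_y.
- exact: valC_z.
- exact: valC_yinv.
Qed.

(** A square root of t' - a exists because k is algebraically closed. The surjectivity is what lets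
    E inherit [centered] from C. *)
Lemma mapf_surj (r : ptE t) : exists p : ptC t t', mapf p = r.
Proof.
case: r => [[[a b] e]|]; last by exists (inf_plus t t').
have e' : onC t t' (sqrtC (t' - a), b).
  move: e; rewrite /onC /onE /rhsC /rhsE !hornerE /= => /eqP ->.
  by rewrite !sqrtCK; apply/eqP; ring.
exists (mk_ptC e'); congr Some; apply: val_inj => /=.
by rewrite sqrtCK opprB addrC subrK.
Qed.

Lemma valE_place r : place iota (valE r).
Proof.
have [p <-] := mapf_surj r; have P := valC_place p.
case: p P => [q|v] P; apply: plane_place; apply: (place_centered P).
- exact: valC_x.
- exact: valC_y.
- exact: valC_z.
- exact: valC_yinv.
Qed.

(** Chain rule: R is the cubic c of E evaluated at A = t' - a^2, so R'(a) = -2a c'(A). Here a is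
    nonzero because R(0) = t'(t' - 1)(t' - t) is, and c has the simple roots 0, 1, t. *)
Lemma rhsC_deriv a : R.[a] = 0 -> R^`().[a] != 0.
Proof.
have /and5P[t0 t1 t'0 t'1 tt'] := ht.
rewrite /rhsC !derivM !derivB !derivC !derivXn !hornerE /=.
move=> E; have a0 : a != 0.
  apply: contra_eqN E => /eqP->.
  by rewrite expr0n !subr0 !mulf_neq0 ?subr_eq0 // eq_sym.
set A := t' - a ^+ 2 in E *.
have BE : t' - 1 - a ^+ 2 = A - 1 by rewrite /A; ring.
have CE : t' - t - a ^+ 2 = A - t by rewrite /A; ring.
rewrite BE CE in E *; clearbody A.
have -> : (- (a + a) * (A - 1) + A * - (a + a)) * (A - t) + A * (A - 1) * - (a
  + a) =
    - (a *+ 2) * (A * (A - 1) + A * (A - t) + (A - 1) * (A - t)) by ring.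
rewrite mulf_neq0 ?oppr_eq0 ?mulrn_eq0 //.
move/eqP: E; rewrite !mulf_eq0 !subr_eq0 -orbA => /or3P[] /eqP ->.
- by have -> : 0 * (0 - 1) + 0 * (0 - t) + (0 - 1) * (0 - t) = t by ring.
- have -> : 1 * (1 - 1) + 1 * (1 - t) + (1 - 1) * (1 - t) = 1 - t by ring.
  by rewrite subr_eq0 eq_sym.
- have -> : t * (t - 1) + t * (t - t) + (t - 1) * (t - t) = t * (t - 1) by ring.
  by rewrite mulf_neq0 ?subr_eq0.
Qed.

Definition cubicE : {poly k} := 'X * ('X - 1) * ('X - t%:P).

Lemma rhsE_cubic a : rhsE t a = cubicE.[a].
Proof. by rewrite /rhsE /cubicE !hornerE. Qed.

Lemma cubicE_deriv a : cubicE.[a] = 0 -> cubicE^`().[a] != 0.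
Proof.
have /and5P[t0 t1 _ _ _] := ht.
rewrite /cubicE -polyC1 !derivM !derivXsubC !derivX !hornerE /=.
move/eqP; rewrite !mulf_eq0 !subr_eq0 -orbA => /or3P[] /eqP ->.
- by have -> : (0 - 1 + 0) * (0 - t) + 0 * (0 - 1) = t by ring.
- have -> : (1 - 1 + 1) * (1 - t) + 1 * (1 - 1) = 1 - t by ring.
  by rewrite subr_eq0 eq_sym.
- have -> : (t - 1 + t) * (t - t) + t * (t - 1) = t * (t - 1) by ring.
  by rewrite mulf_neq0 ?subr_eq0.
Qed.

Lemma xE_cubic : y ^+ 2 = (map_poly iota cubicE).[x].
Proof.
rewrite xE_yE_eq /cubicE -polyC1 !rmorphM !rmorphB /= !map_polyX !map_polyC /=.
by rewrite !hornerE rmorph1.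
Qed.

Lemma xE_neq (a : k) : x - iota a != 0.
Proof.
have <- : - (xi - iota (sqrtC (t' - a))) * (xi - iota (- sqrtC (t' - a))) = x -
  iota a.
  rewrite rmorphN opprK mulNr -subr_sqr -rmorphXn sqrtCK rmorphB /x; ring.
by rewrite mulf_neq0 ?oppr_eq0 ?xi_neq.
Qed.

Lemma double_eq0 (c : k) : (c + c == 0) = (c == 0).
Proof. by rewrite -mulr2n mulrn_eq0. Qed.

Lemma valC_uniformizer_aff (q : affC t t') :
  uniformizer (valC (inl q))
    (if (val q).2 == 0 then y else xi - iota (val q).1).
Proof.
have q2 := eqP (valP q); have cen := affC_centered q.
case: eqP => [b0|/eqP b0].
- apply: (chart_uniformizer_y y_eq q2) => //; last exact: y_neq0.
  by apply: rhsC_deriv; rewrite -q2 b0 expr0n.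
- apply: (chart_uniformizer_x y_eq q2) => //; last exact: xi_neq.
  by rewrite double_eq0.
Qed.

Lemma valC_uniformizer_inf (v : infC k) : uniformizer (valC (inr v)) u.
Proof.
rewrite -[u]subr0 -(rmorph0 iota).
apply: (chart_uniformizer_x w_eq (infC_sqr v) (infC_centered v)).
  by rewrite double_eq0 infC_neq0.
by rewrite rmorph0 subr0 invr_eq0 xi_neq0.
Qed.

Lemma valC_uniformizer p : exists v, uniformizer (valC p) v.
Proof.
case: p => [q|v]; last by exists u; exact: valC_uniformizer_inf.
by eexists; exact: valC_uniformizer_aff.
Qed.

Lemma valE_uniformizer_aff (q : affE t) :
  uniformizer (valE (Some q))
    (if (val q).2 == 0 then y else x - iota (val q).1).
Proof.
have q2 : (val q).2 ^+ 2 = cubicE.[(val q).1].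
  by rewrite -rhsE_cubic; exact: eqP (valP q).
have cen : centered iota x y (val q).1 (val q).2.
  have [[p|v] // [<-]] := mapf_surj (Some q).
  by apply: (place_centered (valC_place (inl p)));
    [exact: valC_x|exact: valC_y].
case: eqP => [b0|/eqP b0].
- apply: (chart_uniformizer_y xE_cubic q2) => //; last exact: y_neq0.
  by apply: cubicE_deriv; rewrite -q2 b0 expr0n.
- apply: (chart_uniformizer_x xE_cubic q2) => //; last exact: xE_neq.
  by rewrite double_eq0.
Qed.

Lemma valE_uniformizer_inf : uniformizer (valE None) (x / y).
Proof.
have P := valE_place None.
have Vz : valE None (x / y) 0 := plane_valX _ _ _ _ _.
have Vv : valE None y^-1 0 := plane_valY _ _ _ _ _.
have y0 := y_neq0.
have x0 : x != 0 by have := xE_neq 0; rewrite rmorph0 subr0.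
apply: plane_uniformizer => //.
- by apply: (place_centered (valC_place (inf_plus t t')));
    [exact: valC_z|exact: valC_yinv].
- by rewrite mulf_neq0 ?invr_eq0.
- by rewrite rmorph0 subr0 divff ?mulf_neq0 ?invr_eq0 //; exact: (regular1 P).
rewrite rmorph0 subr0.
(* The quotient is 1/x, and the equation of E rewrites it as (x - 1)(x - t)/y^2, a product of two
   functions regular at infinity. *)
have -> : y^-1 / (x / y) = (x / y - y^-1) * (x / y - iota t * y^-1).
  have : y ^+ 2 / (x * y ^+ 2) = x * (x - 1) * (x - iota t) / (x * y ^+ 2).
    by rewrite xE_yE_eq.
  move=> E; transitivity (y ^+ 2 / (x * y ^+ 2)); first by field; rewrite x0 y0.
  by rewrite E; field; rewrite x0 y0.
apply: (regularM P).
  by apply: (regularB P); [exists 0|exists 0].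
apply: (regularB P); first by exists 0.
by apply: (regularM P); [exact: (regularC P)|exists 0].
Qed.

Lemma valE_uniformizer r : exists v, uniformizer (valE r) v.
Proof.
case: r => [q|]; last by exists (x / y); exact: valE_uniformizer_inf.
by eexists; exact: valE_uniformizer_aff.
Qed.

(* The branch points of f are those with xi = 0. *)
Definition unramified (p : ptC t t') : bool :=
  if p is inl q then (val q).1 != 0 else true.

(** It suffices to find one common parameter: y over the points of E with y = 0, x minus its value
    at the other affine points, x/y at infinity. *)
Lemma unramified_uniformizer p s : unramified p ->
  uniformizer (valE (mapf p)) s -> uniformizer (valC p) s.
Proof.
move=> up; suff [v uE uC] : exists2 v, uniformizer (valE (mapf p)) v &
  uniformizer (valC p) v.
  by exact: (uniformizer_dominated (valC_place p) (@valE_dominated p) uE uC).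
case: p up => [q|v] /= a0.
- have := valE_uniformizer_aff (mapf_aff q);
    have := valC_uniformizer_aff q => /=.
  case: eqP => [b0|/eqP b0] uC uE; first by exists y.
  exists (x - iota (t' - (val q).1 ^+ 2)) => //.
  (* The second factor has value -2 xi_0, a unit exactly because the point is not a branch point. *)
  have -> : x - iota (t' - (val q).1 ^+ 2) =
      (xi - iota (val q).1) * - (xi + iota (val q).1).
    by rewrite mulrN -subr_sqr rmorphB rmorphXn /x; ring.
  have P := valC_place (inl q).
  apply: (uniformizerM P uC (c := - ((val q).1 + (val q).1))).
    apply: (placeN P); apply: (placeD P); last exact: (placeC P).
    exact: valC_xi.
  by rewrite oppr_eq0 double_eq0.
- exists (x / y); first exact: valE_uniformizer_inf.
  rewrite z_eq; have P := valC_place (inr v).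
  apply: (uniformizerM P (valC_uniformizer_inf v) (valC_zcoef v)).
  by rewrite oppr_eq0 invr_eq0 infC_neq0.
Qed.

(** * Functions regular on a fibre of f *)

(** Separation of even and odd powers of u, with u^2 expressed through c - u^2; for c = t' these
    become functions of x. As in [chart_reduce], g0 and g1 do not depend on the morphism. *)
Lemma even_odd_split (A : comNzRingType) (c : A) (g : {poly {poly A}}) :
  exists g0 g1, forall (C : comNzRingType) (f : {rmorphism A -> C}) u v,
    eval2 f u v g =
    eval2 f (f c - u ^+ 2) v g0 + u * eval2 f (f c - u ^+ 2) v g1.
Proof.
elim/poly2_ind: g => [d|||g h [g0 [g1 IHg]] [h0 [h1 IHh]]|g h [g0 [g1 IHg]] [h0
  [h1 IHh]]].
- by exists d%:P%:P, 0%:P%:P => C f u v; rewrite !eval2C rmorph0 mulr0 addr0.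
- exists 0%:P%:P, 1%:P%:P => C f u v.
  by rewrite eval2X !eval2C rmorph0 rmorph1 mulr1 add0r.
- by exists 'X%:P, 0%:P%:P => C f u v;
    rewrite !eval2Y eval2C rmorph0 mulr0 addr0.
- exists (g0 + h0), (g1 + h1) => C f u v.
  by rewrite !eval2D IHg IHh mulrDr addrACA.
(* The polynomial c - X takes the value u^2 at c - u^2; it comes from the product of the two odd
   parts. *)
- exists (g0 * h0 + (c%:P%:P - 'X) * (g1 * h1)), (g0 * h1 + g1 * h0) => C f u v.
  by rewrite !eval2E IHg IHh; ring.
Qed.

Fact onC_conj (q : affC t t') : onC t t' (- (val q).1, (val q).2).
Proof.
by have := valP q; rewrite /onC /rhsC /= !hornerE /= sqrrN.
Qed.

(** The covering involution of f; it fixes q exactly when xi_0 = 0. *)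
Definition conj_aff (q : affC t t') : affC t t' :=
  exist (fun p => is_true (onC t t' p)) (- (val q).1, (val q).2) (onC_conj q).

Lemma mapf_conj q : mapf_aff (conj_aff q) = mapf_aff q.
Proof. by apply: val_inj; rewrite /= sqrrN. Qed.

Lemma mapf_inl_conj q : mapf (inl (conj_aff q)) = Some (mapf_aff q).
Proof. by rewrite -mapf_conj. Qed.

Lemma mapf_fiber (q : affC t t') (p : ptC t t') :
  mapf p = Some (mapf_aff q) -> p = inl q \/ p = inl (conj_aff q).
Proof.
case: p => [p|v] // [E1 E2].
have /eqP : (val p).1 ^+ 2 = (val q).1 ^+ 2 by apply: oppr_inj;
  apply: (addrI t').
rewrite eqf_sqr => /orP[] /eqP E; [left|right]; congr inl; apply: val_inj => /=.
- by rewrite [LHS]surjective_pairing [RHS]surjective_pairing E E2.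
- by rewrite [LHS]surjective_pairing E E2.
Qed.

(* Prime avoidance: one of the two denominators, or their sum, vanishes at
   neither point of the fibre. *)
Lemma regular_semilocal (q : affC t t') s :
  regular (valC (inl q)) s -> regular (valC (inl (conj_aff q))) s ->
  exists g h, [/\ h.[(val q).1, (val q).2] != 0,
    h.[- (val q).1, (val q).2] != 0 & s = eval2 iota xi y g / eval2 iota xi y
      h].
Proof.
move=> [_ [g [h [h0 sE _]]]] [_ [g' [h' [h0' sE' _]]]].
have [z|nz] := eqVneq h.[- (val q).1, (val q).2] 0; last by exists g, h.
have [z'|nz'] := eqVneq h'.[(val q).1, (val q).2] 0; last by exists g', h'.
exists (g + g'), (h + h'); split; rewrite ?hornerD ?z ?z' ?addr0 ?add0r //.
have nh : eval2 iota xi y h != 0 by apply: contra_neq h0; exact: affC_centered.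
have nh' : eval2 iota xi y h' != 0.
  by apply: contra_neq h0'; exact: (@affC_centered (conj_aff q)).
have nhh : eval2 iota xi y (h + h') != 0.
  apply: (contra_neq (@affC_centered q (h + h'))).
  by rewrite !hornerD z' addr0.
apply: (mulIf nhh); rewrite mulfVK // !eval2D mulrDr {1}sE sE' !mulfVK //.
Qed.

(* A common denominator h becomes a function on E once multiplied by its
   conjugate under xi -> - xi. *)
Lemma regular_conj_decomp (q : affC t t') s :
  let V := valE (Some (mapf_aff q)) in
  regular (valC (inl q)) s -> regular (valC (inl (conj_aff q))) s ->
  exists al be, [/\ regular V al, regular V be & s = al + be * xi].
Proof.
move=> V s1 s2; have [g [h [h1 h2 sE]]] := regular_semilocal s1 s2.
have P := valE_place (Some (mapf_aff q)).
have [g0 [g1 gE]] := even_odd_split t' g;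
  have [h0 [h1' hE]] := even_odd_split t' h.
set a := (val q).1 in h1 h2; set b := (val q).2 in h1 h2.
have ev (m : {poly {poly k}}) : V (eval2 iota x y m) m.[t' - a ^+ 2, b].
  exact: plane_val_eval2.
(* The norm (h0 + xi h1)(h0 - xi h1) with xi^2 replaced by t' - x. Its value is the product of the
   values of h at the two points of the fibre, hence nonzero. *)
pose N := eval2 iota x y h0 ^+ 2 - (iota t' - x) * eval2 iota x y h1' ^+ 2.
have VN : V N (h.[a, b] * h.[- a, b]).
  have -> : h.[a, b] * h.[- a, b] =
      h0.[t' - a ^+ 2, b] ^+ 2 - (t' - (t' - a ^+ 2)) * h1'.[t' - a ^+ 2, b] ^+
        2.
    by rewrite -!(eval2_id _ b) !hE /= sqrrN; ring.
  apply: (placeB P); first exact: (placeX P _ (ev _)).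
  apply: (placeM P); last exact: (placeX P _ (ev _)).
  by apply: (placeB P); [exact: (placeC P)|exact: plane_valX].
have N0 : N != 0 by apply: (place_nz P VN); rewrite mulf_neq0.
have VNi : regular V N^-1.
  by exists (h.[a, b] * h.[- a, b])^-1; apply: (placeV P VN); rewrite mulf_neq0.
have reg (m : {poly {poly k}}) : regular V (eval2 iota x y m) by eexists;
  exact: ev.
have regx : regular V (iota t' - x).
  by apply: (regularB P); [exact: (regularC P)|eexists; exact: plane_valX].
pose G0 := eval2 iota x y g0; pose G1 := eval2 iota x y g1.
pose H0 := eval2 iota x y h0; pose H1 := eval2 iota x y h1'.
(* Even and odd parts of (G0 + xi G1)(H0 - xi H1), divided by the norm. *)
exists ((G0 * H0 - (iota t' - x) * (G1 * H1)) / N), ((G1 * H0 - G0 * H1) / N).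
have NE : N = eval2 iota xi y h * (H0 - xi * H1).
  by rewrite hE -/x /N -/H0 -/H1 /x; ring.
split.
- apply: (regularM P) => //; apply: (regularB P); first by apply: (regularM P);
    exact: reg.
  by apply: (regularM P) => //; apply: (regularM P); exact: reg.
- by apply: (regularM P) => //; apply: (regularB P); apply: (regularM P);
    exact: reg.
have /andP[nh _] : (eval2 iota xi y h != 0) && (H0 - xi * H1 != 0).
  by move: N0; rewrite NE mulf_eq0 negb_or.
rewrite [X in _ = _ + X]mulrAC -mulrDl; apply: (canRL (mulfK N0)).
by rewrite NE sE mulrA mulfVK // gE -/x -/G0 -/G1 /x; ring.
Qed.

(** Replacing X by -X fixes U and changes the sign of the second term; the sum of the two relations
    is twice the even part, and the characteristic is 0. *)
Lemma even_odd_free (p p' : {poly k}) :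
  let U := t'%:P - 'X^2 in
  (p \Po U) + 'X * (p' \Po U) = 0 -> p \Po U = 0 /\ p' \Po U = 0.
Proof.
move=> U E; have UN : U \Po (- 'X) = U.
  by rewrite /U comp_polyB comp_polyC comp_Xn_poly sqrrN.
have E' := congr1 (comp_poly (- 'X)) E.
rewrite comp_polyD comp_polyM -!comp_polyA UN comp_polyX comp_poly0 in E'.
have p0 : p \Po U = 0.
  have : 2 *: (p \Po U) = 0.
    by rewrite scaler_nat -[RHS](addr0 0) -{1}E -E'; ring.
  by move/eqP; rewrite scaler_eq0 pnatr_eq0 => /eqP.
split=> //; move/eqP: E; rewrite p0 add0r mulf_eq0 polyX_eq0 => /eqP //.
Qed.

(** With denominators cleared and x = t' - xi^2 substituted, independence of 1 and y over k[xi]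
    leaves two polynomial relations in xi, each of which splits by parity. *)
Lemma xE_free (q : affE t) al be :
  let V := valE (Some q) in
  regular V al -> regular V be -> al + be * xi = 0 -> al = 0 /\ be = 0.
Proof.
move=> V [_ [g [h [h0 -> _]]]] [_ [g' [h' [h0' -> _]]]] E.
have nz (m : {poly {poly k}}) : m.[(val q).1, (val q).2] != 0 -> eval2 iota x y
  m != 0.
  move=> m0; apply: (place_nz (valE_place (Some q)) _ m0).
  exact: plane_val_eval2.
have E2 : eval2 iota x y (g * h') + eval2 iota x y (g' * h) * xi = 0.
  move/(congr1 (fun s => s * (eval2 iota x y h * eval2 iota x y h'))): E.
  rewrite mul0r => <-; rewrite !eval2M; field.
  by rewrite !nz.
have [p [p' redp]] := chart_reduce cubicE (g * h').
have [r [r' redr]] := chart_reduce cubicE (g' * h).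
pose U : {poly k} := t'%:P - 'X^2.
have UE (m : {poly k}) : (map_poly iota m).[x] = (map_poly iota (m \Po U)).[xi].
  rewrite map_comp_poly horner_comp; congr (_ .[_]).
  by rewrite /U rmorphB /= map_polyC map_polyXn !hornerE.
rewrite (redp _ _ _ _ xE_cubic) (redr _ _ _ _ xE_cubic) !UE in E2.
have [|E3 E4] := @xi_free ((p \Po U) + 'X * (r \Po U)) ((p' \Po U) + 'X * (r'
  \Po U)).
  rewrite -E2 !(rmorphD, rmorphM) /= map_polyX !(hornerD, hornerM, hornerX);
    ring.
have [p0 r0] := even_odd_free E3; have [p0' r0'] := even_odd_free E4.
have := redp _ _ _ _ xE_cubic; have := redr _ _ _ _ xE_cubic.
rewrite !UE p0 r0 p0' r0' rmorph0 horner0 mul0r addr0 !eval2M.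
move=> /eqP + /eqP; rewrite !mulf_eq0 (negbTE (nz _ h0)) (negbTE (nz _ h0'))
  !orbF.
by move=> /eqP -> /eqP ->; rewrite !mul0r.
Qed.

(** Over a root a of d lie only the points whose second coordinate is a square root of R(a). *)
Lemma finite_affC (d : {poly k}) : d != 0 ->
  finite_set [set q : affC t t' | d.[(val q).1] = 0].
Proof.
move=> d0; have [rs dE] := closed_field_poly_normal d.
pose cand := [seq (a, sqrtC R.[a]) | a <- rs] ++ [seq (a, - sqrtC R.[a]) | a <-
  rs].
apply: (sub_finite_set (B := [set` (pmap insub cand : seq (affC t t'))]));
  last exact: finite_seq.
move=> q /= q0; rewrite mem_pmap_sub.
have qr : (val q).1 \in rs.
  have : root d (val q).1 by apply/rootP.
  by rewrite dE rootZ ?lead_coef_eq0 // root_prod_XsubC.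
have := eqP (valP q); rewrite -[R.[_]]sqrtCK => /eqP;
  rewrite eqf_sqr => /orP[] /eqP e.
- rewrite mem_cat; apply/orP; left; apply/mapP; exists (val q).1 => //.
  by rewrite -e -surjective_pairing.
- rewrite mem_cat; apply/orP; right; apply/mapP; exists (val q).1 => //.
  by rewrite -e -surjective_pairing.
Qed.

Lemma finite_infC : finite_set [set: infC k].
Proof.
have [cand candE] : exists s, s = [:: 'i; - 'i] :> seq k by eexists.
apply: (sub_finite_set (B := [set` (pmap insub cand : seq (infC k))]));
  last exact: finite_seq.
move=> v _ /=; rewrite mem_pmap_sub candE !inE -eqf_sqr sqrCi; exact: (valP v).
Qed.

Lemma finite_irregular s : finite_set [set p | ~ regular (valC p) s].
Proof.
have [p [q [d [d0 ->]]]] := ff_frac s.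
apply: (sub_finite_set (B := inl @` [set q | d.[(val q).1] = 0] `|` inr @`
  [set: infC k])).
  case=> [r|v] /= nreg; last by right; exists v.
  left; exists r => //; apply/eqP; apply: contra_notT nreg => dr.
  have P := valC_place (inl r).
  have Vxi := valC_xi r.
  apply: (regularM P); last first.
    by eexists; apply: (placeV P _ dr); exact: (place_horner d P Vxi).
  apply: (regularD P); first by eexists; exact: (place_horner p P Vxi).
  apply: (regularM P); first by eexists; exact: (place_horner q P Vxi).
  by eexists; exact: valC_y.
rewrite finite_setU; split; apply: finite_image;
  [exact: finite_affC|exact: finite_infC].
Qed.

(** * The direct image and its elementary transforms *)

(** The curves C and E over the abstract field; at K = [kC] they unfold to [curveC] and [curveE], so
    the final statement follows by conversion. *)
Definition modelC : curve K := @Curve K (ptC t t') (fun p =>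
  match p with
  | inl q => plane_loc iota xi y (val q).1 (val q).2
  | inr v => plane_loc iota xi^-1 (y / xi ^+ 3) 0 (val v)
  end).

Definition modelE : curve K := @Curve K (ptE t) (fun p =>
  match p with
  | Some q => plane_loc iota x y (val q).1 (val q).2
  | None => plane_loc iota (x / y) y^-1 0 0
  end).

Definition modelf : modelC -> modelE := @mapf k t t'.

Lemma loc_modelC (p : modelC) : loc p = regular (valC p).
Proof. by case: p => q; exact: plane_locE. Qed.

Lemma loc_modelE (r : modelE) : loc r = regular (valE r).
Proof. by case: r => [q|]; exact: plane_locE. Qed.

Lemma local_paramC (p : modelC) tau :
  local_param p tau <-> uniformizer (valC p) tau.
Proof. exact: local_paramP (valC_place p) (loc_modelC p) tau. Qed.

Lemma local_paramE (r : modelE) tau :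
  local_param r tau <-> uniformizer (valE r) tau.
Proof. exact: local_paramP (valE_place r) (loc_modelE r) tau. Qed.

(* The stalk of f_* O_C. *)
Definition fiber_regular (r : modelE) : set K :=
  [set s | forall p : modelC, modelf p = r -> loc p s].

Lemma fiber_regular_aff (q : affC t t') s :
  fiber_regular (Some (mapf_aff q)) s <->
  regular (valC (inl q)) s /\ regular (valC (inl (conj_aff q))) s.
Proof.
split=> [reg|[reg1 reg2] p /mapf_fiber].
  split; [rewrite -[regular _]loc_modelC|rewrite -[regular _]loc_modelC];
    apply: reg => //.
  exact: mapf_inl_conj.
by case=> ->; rewrite loc_modelC.
Qed.

Lemma finite_fiber_irregular s : finite_set [set r | ~ fiber_regular r s].
Proof.
apply: (sub_finite_set (B := modelf @` [set p | ~ regular (valC p) s])).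
  move=> r /= /existsNP[p /not_implyP[pr nreg]]; exists p => //.
  by rewrite /= -loc_modelC.
by apply: finite_image; exact: finite_irregular.
Qed.

Lemma valE_regular_fiber (p : modelC) s : regular (valE (modelf p)) s ->
  regular (valC p) s.
Proof. by move=> [c Vs]; exists c; exact: valE_dominated. Qed.

(** * One elementary transform at a point of E that is not a branch point *)

Section ElementaryTransform.
Variables (q : affC t t') (F : subsheaf modelE).
Hypothesis a0 : (val q).1 != 0.
Local Notation r := (Some (mapf_aff q) : modelE).
Local Notation p1 := (inl q : modelC).
Local Notation p2 := (inl (conj_aff q) : modelC).
Local Notation v := (iota (val q).1 + xi).
Hypothesis stalkF : stalk F r = fiber_regular r.

Lemma valC_v : valC p2 v 0.
Proof.
have P := valC_place p2;
  have := placeD P (placeC P (val q).1) (valC_xi (conj_aff q)).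
by rewrite /= subrr.
Qed.

Lemma uniformizer_over s : uniformizer (valE r) s ->
  uniformizer (valC p1) s /\ uniformizer (valC p2) s.
Proof.
move=> us; split; first exact: (@unramified_uniformizer p1).
apply: (@unramified_uniformizer p2); first by rewrite /= oppr_eq0.
by rewrite mapf_inl_conj.
Qed.

Lemma fiber_regularP s :
  fiber_regular r s <-> exists al be, [/\ loc r al, loc r be & s = al * v + be
    * 1].
Proof.
rewrite fiber_regular_aff loc_modelE; have P := valE_place r; split.
  move=> [s1 s2]; have [al [be [Val Vbe ->]]] := regular_conj_decomp s1 s2.
  exists be, (al - be * iota (val q).1); split=> //; last by ring.
  by apply: (regularB P) => //; apply: (regularM P) => //; exact: (regularC P).
move=> [al [be [Val Vbe ->]]]; rewrite mulr1; split.
- have P1 := valC_place p1; apply: (regularD P1);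
    last exact: (@valE_regular_fiber p1).
  apply: (regularM P1); first exact: (@valE_regular_fiber p1).
  by apply: (regularD P1); [exact: (regularC P1)|eexists; exact: valC_xi].
- have E2 := mapf_inl_conj q.
  have P2 := valC_place p2; apply: (regularD P2).
    apply: (regularM P2); last by eexists; exact: valC_v.
    by apply: (@valE_regular_fiber p2); rewrite /modelf E2.
  by apply: (@valE_regular_fiber p2); rewrite /modelf E2.
Qed.

Lemma local_basis_v : local_basis F r v 1.
Proof.
have P := valE_place r.
split; first by rewrite stalkF; apply/seteqP; split=> s /fiber_regularP.
move=> al be; rewrite loc_modelE => Val Vbe E.
have [||E1 al0] := @xE_free (mapf_aff q) (al * iota (val q).1 + be) al _ Val.
- by apply: (regularD P) => //; apply: (regularM P) => //; exact: (regularC P).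
- by rewrite -E; ring.
by move: E1; rewrite al0 mul0r add0r => ->.
Qed.

(** The left side allows any parameter and any basis with e1 congruent to v, so the direct
    implication may use only the class of e1 in the fibre. The converse supplies the basis (v,
    1). *)
Lemma elm_conditionP s :
  (exists tau e1 e2, [/\ local_param r tau, local_basis F r e1 e2,
     same_fiber F r e1 v & span2 r (tau^-1 * e1) e2 s]) <->
  (exists tau, local_param p1 tau /\ loc p1 (tau * s)) /\ loc p2 s.
Proof.
have P := valE_place r; have P1 := valC_place p1; have P2 := valC_place p2.
have E2 := mapf_inl_conj q.
rewrite !loc_modelC; split.
  move=> [tau [e1 [e2 [/local_paramE ut [stE _] e1v [al [be [Val Vbe ->]]]]]]].
  have [ut1 ut2] := uniformizer_over ut.
  rewrite loc_modelE in Val Vbe.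
  have Val1 := @valE_regular_fiber p1 _ Val;
    have Vbe1 := @valE_regular_fiber p1 _ Vbe.
  have Val2 : regular (valC p2) al by apply: (@valE_regular_fiber p2);
    rewrite /modelf E2.
  have Vbe2 : regular (valC p2) be by apply: (@valE_regular_fiber p2);
    rewrite /modelf E2.
  have [r1 r0] : loc r 1 /\ loc r 0.
    by rewrite loc_modelE; split; [exact: (regular1 P)|exact: (regular0 P)].
  have /fiber_regular_aff[e11 e12] : fiber_regular r e1.
    by rewrite -stalkF stE; exists 1, 0; rewrite mul1r mul0r addr0.
  have /fiber_regular_aff[e21 e22] : fiber_regular r e2.
    by rewrite -stalkF stE; exists 0, 1; rewrite mul1r mul0r add0r.
  (* The difference e1 - v lies in the maximal ideal of r times the stalk; all such functions vanish
     at p2, and so does v. *)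
  have e1_0 : valC p2 e1 0.
    rewrite -(subrK v e1) -(addr0 0); apply: (placeD P2); last exact: valC_v.
    apply: (mod_prod_sub (C := [set s | valC p2 s 0])) e1v => [|a b Va Vb|a b].
    - by rewrite /= -{1}(rmorph0 iota); exact: (placeC P2).
    - by rewrite /= -(addr0 0); exact: (placeD P2).
    rewrite (max_idealE P (loc_modelE r)) stalkF => Va /fiber_regular_aff[_ Vb].
    by apply: (place_eq0M P2) => //; apply: valE_dominated; rewrite E2.
  have [t0 Vt _] := ut1; split.
    exists tau; split; first exact/local_paramC.
    rewrite mulrDr mulrCA mulVKf //; apply: (regularD P1).
      exact: (regularM P1).
    apply: (regularM P1); first by exists 0.
    exact: (regularM P1).
  apply: (regularD P2); last exact: (regularM P2).
  apply: (regularM P2) => //; rewrite mulrC.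
  by have [_ _] := ut2; apply.
move=> [[tau [/local_paramC ut Vts]] Vs].
have [u0 uu] := valE_uniformizer r.
have [u1 u2] := uniformizer_over uu.
have [n0 Vu1 _] := u1; have [_ Vu2 _] := u2; have [tau0 _ utP] := ut.
have reg1 : regular (valC p1) (u0 * s).
  have -> : u0 * s = u0 / tau * (tau * s) by rewrite mulrA mulfVK.
  by apply: (regularM P1) => //; exact: utP.
have val2 : valC p2 (u0 * s) 0 by exact: (place_eq0M P2).
(* Multiplication by u0 cancels the simple pole at p1, so the product has coordinates al, be in the
   basis (v, 1). *)
have /fiber_regularP[al [be [Val Vbe E]]] : fiber_regular r (u0 * s).
  by apply/fiber_regular_aff; split=> //; exists 0.
have Val2 : regular (valC p2) al.
  by apply: (@valE_regular_fiber p2); rewrite /modelf E2 -[regular _]loc_modelE.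
(* At p2 both u0 s and v vanish, hence be does too; as be is regular at r, it has the same value
   there, and so u0 divides it on E. *)
have be0 : valE r be 0.
  rewrite loc_modelE in Vbe; have [c Vc] := Vbe.
  have Vc2 : valC p2 be c by apply: valE_dominated; rewrite E2.
  have Vb2 : valC p2 be 0.
    have -> : be = u0 * s - v * al by rewrite E; ring.
    by rewrite -(subr0 0); apply: (placeB P2) => //;
      apply: (place_eq0M P2) => //; exact: valC_v.
  by rewrite -(place_inj P2 Vc2 Vb2).
exists u0, v, 1; split.
- exact/local_paramE.
- exact: local_basis_v.
- by rewrite /same_fiber subrr; exact: mod_prod0.
exists al, (be / u0); split=> //; first by rewrite loc_modelE; case: uu => _ _;
  apply.
by apply: (mulfI n0); rewrite E; field.
Qed.

End ElementaryTransform.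

(** * The twist at infinity and the comparison of the two sheaves *)

Local Notation inf := (None : modelE).
Local Notation E0 := (pushforward modelf (@struct_sheaf _ modelC)).
Local Notation twist := (div_sheaf (\- pt_div inf)).
Local Notation E0m := (tensor E0 twist).

Lemma stalk_pushforward r : stalk E0 r = fiber_regular r.
Proof.
have -> : E0 = pointwise fiber_regular.
  apply/funext => U; apply/seteqP; split=> s /= Us.
    by move=> r' Ur p pr; apply: Us; rewrite /= pr.
  by move=> p Up; exact: Us Up p erefl.
by apply: stalk_pointwise => s; exact: finite_fiber_irregular.
Qed.

Lemma div_regularE0 (D : modelE -> int) r s :
  D r = 0 -> div_regular D r s <-> loc r s.
Proof.
apply: div_regular0; have [u0 uu] := valE_uniformizer r.
by exists u0; exact/local_paramE.
Qed.

Lemma div_regular_inf s :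
  div_regular (\- pt_div inf) inf s -> valE inf s 0.
Proof.
move=> [tau [/local_paramE[t0 Vt _]]];
  rewrite loc_modelE /= /pt_div eqxx exprN1 => Vs.
rewrite -(mulVKf t0 s); exact: (place_eq0M (valE_place inf)).
Qed.

Lemma twist_aff q : (\- pt_div inf) (Some q : modelE) = 0.
Proof. by []. Qed.

Lemma stalk_twist_sub r : stalk twist r `<=` div_regular (\- pt_div inf) r.
Proof. exact: stalk_pointwise_sub. Qed.

Lemma stalk_twist_aff (q : affE t) : stalk twist (Some q) 1.
Proof.
exists [set r | r <> inf]; split=> //.
  apply: (sub_finite_set (B := [set inf])); last exact: finite_set1.
  by move=> r /= /contrapT.
case=> [p|] //= _; apply/(div_regularE0 _ (twist_aff p)).
by rewrite loc_modelE; exact: (regular1 (valE_place (Some p))).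
Qed.

Lemma stalk_twist_inf : stalk twist inf (x / y).
Proof.
have zinf : div_regular (\- pt_div inf) inf (x / y).
  exists (x / y); split; first exact/local_paramE/valE_uniformizer_inf.
  rewrite loc_modelE /= /pt_div eqxx exprN1 mulVf.
    exact: (regular1 (valE_place inf)).
  by have [] := valE_uniformizer_inf.
exists [set r | div_regular (\- pt_div inf) r (x / y)]; split=> //.
- have fin : finite_set [set q : affE t | (val q).2 = 0].
    (* The points of E with y = 0, the only affine ones where x/y can fail to be regular. *)
    pose cand : seq (k * k) := [:: (0, 0); (1, 0); (t, 0)].
    have [s sE] : exists s, s = cand by exists cand.
    apply: (sub_finite_set (B := [set` (pmap insub s : seq (affE t))]));
      last exact: finite_seq.
    move=> [[a b] e] /= b0; rewrite mem_pmap_sub sE !inE /=.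
    move: e; rewrite /onE /rhsE /= b0 expr0n eq_sym !mulf_eq0 !subr_eq0 -orbA.
    by rewrite !xpair_eqE eqxx !andbT.
  apply: (sub_finite_set (B := Some @` [set q : affE t | (val q).2 = 0]));
    last exact: finite_image.
  case=> [q|] /= nreg.
    exists q => //; apply/eqP; apply: contra_notT nreg => q0.
    apply/(div_regularE0 _ (twist_aff q)); rewrite loc_modelE.
    have P := valE_place (Some q); apply: (regularM P).
      by eexists; exact: plane_valX.
    by eexists; apply: (placeV P _ q0); exact: plane_valY.
by case: nreg.
Qed.

Lemma fiber_regular0 r : fiber_regular r 0.
Proof. by move=> p _; rewrite loc_modelC; exact: (regular0 (valC_place p)). Qed.

Lemma fiber_regularD r a b :
  fiber_regular r a -> fiber_regular r b -> fiber_regular r (a + b).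
Proof.
move=> ra rb p pr; have := rb p pr; have := ra p pr.
by rewrite loc_modelC; exact: (regularD (valC_place p)).
Qed.

Lemma mod_prod_aff (q : affE t) :
  mod_prod (stalk E0 (Some q)) (stalk twist (Some q)) = fiber_regular (Some q).
Proof.
rewrite stalk_pushforward; apply/seteqP; split=> s.
  apply: mod_prod_sub; [exact: fiber_regular0|exact: fiber_regularD|].
  move=> a b ra /stalk_twist_sub/(div_regularE0 _ (twist_aff q)).
  rewrite loc_modelE => Vb p pr; rewrite loc_modelC;
    apply: (regularM (valC_place p)).
    by rewrite -[regular _]loc_modelC; exact: ra.
  by apply: valE_regular_fiber; rewrite pr.
by move=> rs; rewrite -(mulr1 s); apply: mod_prodM => //;
  exact: stalk_twist_aff.
Qed.

Lemma mod_prod_inf s :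
  mod_prod (stalk E0 inf) (stalk twist inf) s <->
  forall p : modelC, modelf p = inf -> valC p s 0.
Proof.
rewrite stalk_pushforward; split.
  move=> + p pr; have P := valC_place p; move: s.
  apply: (@mod_prod_sub _ _ _ [set s | valC p s 0]).
  - by rewrite /= -{1}(rmorph0 iota); exact: (placeC P).
  - by move=> a b /= Va Vb; rewrite -(addr0 0); exact: (placeD P).
  move=> a b /(_ p pr);
    rewrite loc_modelC => ra /stalk_twist_sub/div_regular_inf Vb /=.
  by rewrite mulrC; apply: (place_eq0M P) => //; apply: valE_dominated;
    rewrite [mapf p]pr.
move=> Vs; have [z0 _ _] := valE_uniformizer_inf.
(* With z = x/y, the factorization s = (s/z) z works because z is a parameter at every point of C
   over infinity, so s/z is regular there. *)
rewrite -(divfK z0 s); apply: mod_prodM; last exact: stalk_twist_inf.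
move=> p pr; rewrite loc_modelC.
have ur : unramified p by case: p pr.
have [|_ _] := unramified_uniformizer ur (s := x / y).
  by rewrite [mapf p]pr; exact: valE_uniformizer_inf.
by apply; exact: Vs.
Qed.

Lemma finite_mod_prod_irregular s :
  finite_set [set r | ~ mod_prod (stalk E0 r) (stalk twist r) s].
Proof.
apply: (sub_finite_set (B := [set inf] `|` [set r | ~ fiber_regular r s])).
  by case=> [q|] /= nreg; [right; rewrite -mod_prod_aff|left].
rewrite finite_setU; split; first exact: finite_set1.
exact: finite_fiber_irregular.
Qed.

Lemma stalk_E0m r : stalk E0m r = mod_prod (stalk E0 r) (stalk twist r).
Proof.
apply: (@stalk_pointwise _ modelE
  (fun r => mod_prod (stalk E0 r) (stalk twist r))).
exact: finite_mod_prod_irregular.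
Qed.

Lemma stalk_E0m_aff (q : affE t) : stalk E0m (Some q) = fiber_regular (Some q).
Proof. by rewrite stalk_E0m mod_prod_aff. Qed.

(** Both sides are pointwise, so the conditions are compared at q1, at q2, at the other affine
    points and at infinity. Since q1 and q2 differ, each transform leaves the stalk at the other
    point alone. *)
Theorem model_corollary (xi1 y1 xi2 y2 : k)
  (hq1 : onC t t' (xi1, y1)) (hq2 : onC t t' (xi2, y2))
  (hxi1 : xi1 != 0) (hxi2 : xi2 != 0) :
  let qt1 : modelC := mk_ptC hq1 in
  let qt2 : modelC := mk_ptC hq2 in
  let infp : modelC := inf_plus t t' in
  let infm : modelC := inf_minus t t' in
  let q1 : modelE := modelf qt1 in
  let q2 : modelE := modelf qt2 in
  q1 != q2 ->
  sheaf_eq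
    (pushforward modelf
       (div_sheaf (pt_div qt1 \+ pt_div qt2 \- pt_div infp \- pt_div infm)))
    (elm q1 (iota xi1 + xi) (elm q2 (iota xi2 + xi) E0m)).
Proof.
move=> qt1 qt2 infp infm q1 q2 q12 U _.
set D := (_ \- pt_div infm).
pose a1 : affC t t' := exist (fun p => is_true (onC t t' p)) (xi1, y1) hq1.
pose a2 : affC t t' := exist (fun p => is_true (onC t t' p)) (xi2, y2) hq2.
have finM s : finite_set [set r | ~ stalk E0m r s].
  apply: sub_finite_set (finite_mod_prod_irregular s) => r /=.
  by rewrite stalk_E0m.
have conj_ne (a : affC t t') : (val a).1 != 0 -> (inl (conj_aff a) : modelC) !=
  inl a.
  move=> a0; apply/eqP => -[] /(congr1 val) /(congr1 fst) /= /eqP.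
  by rewrite -subr_eq0 -opprD oppr_eq0 double_eq0 (negbTE a0).
have qt12 : (qt1 == qt2) = false by apply: contraNF q12 => /eqP;
  rewrite /q1 /q2 => ->.
have other (p : modelC) : modelf p != q1 -> modelf p != q2 ->
    (p == qt1) = false /\ (p == qt2) = false.
  by move=> n1 n2; split; [apply: contraNF n1|apply: contraNF n2] => /eqP->.
suff main r s : (forall p, modelf p = r -> div_regular D p s) <->
    elm_at q1 (iota xi1 + xi) (elm q2 (iota xi2 + xi) E0m) r s.
  apply/seteqP; split=> s Us.
    by move=> r Ur; apply/main => p pr; apply: Us; rewrite /= pr.
  by move=> p Up; apply: (main (modelf p) s).2 => //; exact: Us.
have divE (p : modelC) n : D p = n ->
    div_regular D p s = exists tau, local_param p tau /\ loc p (tau ^ n * s).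
  by move=> <-.
have div0 p : D p = 0 -> div_regular D p s <-> loc p s.
  apply: div_regular0; have [u0 uu] := valC_uniformizer p.
  by exists u0; exact/local_paramC.
(* Common to q1 and q2: it asks only for the untransformed stalk of F at the point and the
   coefficients 1 and 0 of D on the fibre. *)
have elmcase (a : affC t t') (F : subsheaf modelE) : (val a).1 != 0 ->
    stalk F (Some (mapf_aff a)) = fiber_regular (Some (mapf_aff a)) ->
    D (inl a) = 1 -> D (inl (conj_aff a)) = 0 ->
    (forall p, modelf p = Some (mapf_aff a) -> div_regular D p s) <->
    elm_at (Some (mapf_aff a) : modelE) (iota (val a).1 + xi) F (Some (mapf_aff
      a)) s.
  move=> a0 stF D1 D0; rewrite /elm_at /= eqxx elm_conditionP // -(div0 _ D0).
  have -> : (exists tau, local_param (inl a : modelC) tau /\ loc (inl a :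
    modelC) (tau * s)) =
      div_regular D (inl a) s by rewrite /div_regular /= D1.
  split; first by move=> H; split; apply: H => //; exact: mapf_inl_conj.
  by move=> [H1 H2] p /mapf_fiber[] ->.
have DE (a : affC t t') : D (inl a) = ((inl a : modelC) == qt1)%:Z + ((inl a :
  modelC) == qt2)%:Z.
  by rewrite /D /pt_div /= !subr0.
have [->|rq1] := eqVneq r q1.
  apply: (elmcase a1) => //.
  - by rewrite (stalk_elm _ _ _ finM) elm_at_neq // stalk_E0m_aff.
  - by rewrite DE -[inl a1]/qt1 eqxx qt12.
  (* The conjugate differs from [qt1] because xi1 is nonzero, and from [qt2] because it lies over
     q1. *)
  - rewrite DE (negbTE (conj_ne a1 hxi1)) add0r.
    case: eqP => // /(congr1 modelf) E; case/eqP: q12.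
    by rewrite -[q2]E; apply/esym; exact: mapf_inl_conj.
rewrite elm_at_neq // (stalk_elm _ _ _ finM).
have [->|rq2] := eqVneq r q2.
  apply: (elmcase a2) => //.
  - exact: stalk_E0m_aff.
  - by rewrite DE -[inl a2]/qt2 eqxx [qt2 == _]eq_sym qt12.
  - rewrite DE (negbTE (conj_ne a2 hxi2)) addr0.
    case: eqP => // /(congr1 modelf) E; case/eqP: q12.
    by rewrite -[q1]E; exact: mapf_inl_conj.
rewrite elm_at_neq //.
case: r rq1 rq2 => [q|] rq1 rq2.
  rewrite stalk_E0m_aff; have D0 p : modelf p = Some q -> D p = 0.
    move=> pr; have [] := other p; rewrite ?pr //.
    by case: p pr => // a _ n1 n2; rewrite DE n1 n2.
  by split=> H p pr; [apply/(div0 _ (D0 _ pr))|apply/(div0 _ (D0 _ pr))];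
    exact: H.
rewrite stalk_E0m mod_prod_inf.
(* Every point at infinity has w = i or w = -i, and these differ, so exactly one of the two terms
   contributes. *)
have Dinf (v : infC k) : D (inr v) = -1.
  have : (val v == 'i) || (val v == - 'i) by rewrite -eqf_sqr sqrCi;
    exact: (valP v).
  have i2 : ('i == - 'i :> k) = false.
    by rewrite -subr_eq0 opprK double_eq0 (negbTE (neq0Ci k)).
  rewrite /D /pt_div /=.
  have eqE (c : infC k) : ((inr v : modelC) == inr c) = (val v == val c) by [].
  rewrite !eqE /= => /orP[] /eqP ->; first by rewrite eqxx i2.
  by rewrite eqxx eq_sym i2.
have inf0 v : div_regular D (inr v) s <-> valC (inr v) s 0.
  have P := valC_place (inr v); rewrite (divE _ _ (Dinf v)); split.
    move=> [tau [/local_paramC[t0 Vt _]]]; rewrite loc_modelC exprN1 => Vs.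
    by rewrite -(mulVKf t0 s); exact: (place_eq0M P).
  move=> Vs; have uu := valC_uniformizer_inf v; exists xi^-1.
  split; first exact/local_paramC.
  by rewrite loc_modelC exprN1 mulrC; have [_ _] := uu; apply.
by split=> H [a|v] // pr; apply/inf0; exact: H.
Qed.

End CurveModel.

(** * Eigenvectors, and the return to the concrete function field *)

Lemma v2_eigenvector (k : numFieldType) (a : k) :
  a != 0 -> eigenvector (Mxi a) 1 (v2 a).
Proof.
move=> a0; split.
  apply/eqP => /matrixP/(_ ord_max ord0) /eqP.
  by rewrite !mxE /= oner_eq0.
rewrite scale1r; apply/matrixP => i j.
rewrite !mxE !big_ord_recl big_ord0 !mxE /=.
have two : (2 : k) != 0 by rewrite pnatr_eq0.
by case: i => [[|[|i]]] //= _; field; rewrite ?a0 ?two.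
Qed.

Lemma germ_v2 (k : numClosedFieldType) (t t' : k)
  (ht : [&& t != 0, t != 1, t' != 0, t' != 1 & t != t']) (a : k) :
  germ ht (v2 a) = kC_of_k ht a + xiC ht.
Proof. by rewrite /germ !mxE /= rmorph1 mulr1 mul1r. Qed.

Theorem corollary2 (R : realType) (t t' : R[i])
  (ht : [&& t != 0, t != 1, t' != 0, t' != 1 & t != t'])
  (xi1 y1 xi2 y2 : R[i])
  (hq1 : onC t t' (xi1, y1)) (hq2 : onC t t' (xi2, y2))
  (hxi1 : xi1 != 0) (hxi2 : xi2 != 0) :
  let qt1 : curveC ht := mk_ptC hq1 in
  let qt2 : curveC ht := mk_ptC hq2 in
  let infp : curveC ht := inf_plus t t' in
  let infm : curveC ht := inf_minus t t' in
  let q1 : curveE ht := fCE qt1 in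
  let q2 : curveE ht := fCE qt2 in
  let L : subsheaf (curveC ht) :=
    div_sheaf (pt_div qt1 \+ pt_div qt2 \- pt_div infp \- pt_div infm) in
  let E : subsheaf (curveE ht) := pushforward (@fCE _ _ _ ht) L in
  let E0 : subsheaf (curveE ht) :=
    pushforward (@fCE _ _ _ ht) (@struct_sheaf _ (curveC ht)) in
  let E0m : subsheaf (curveE ht) :=
    tensor E0 (div_sheaf (\- pt_div (infE ht))) in
  q1 != q2 ->
  [/\ eigenvector (Mxi xi1) 1 (v2 xi1),
      eigenvector (Mxi xi2) 1 (v2 xi2)
    & sheaf_eq E
        (elm q1 (germ ht (v2 xi1)) (elm q2 (germ ht (v2 xi2)) E0m))].
Proof.
move=> qt1 qt2 infp infm q1 q2 L E E0 E0m q12.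
split; [exact: v2_eigenvector|exact: v2_eigenvector|].
rewrite !germ_v2.
have free := @kC_free _ _ _ ht; have span := @kC_span _ _ _ ht;
  have sqr := yC_sqr ht.
exact: (model_corollary ht (xi_free free) (xi_inv_free free) (ff_frac span)
  (y_eq sqr) hxi1 hxi2 q12).
Qed.
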